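(* Let $M$ be a von Neumann algebra with a fixed (faithful normal) tracial state $\varphi$, and let $X=\{x_1,\ldots,x_n\}$ be a finite $n$-tuple ($n\ge1$) of selfadjoint elements of $M$. If $y=y^*$ is in the von Neumann algebra generated by $X$, then $\chi(X\cup\{y\})=-\infty$.
   Context: For an $N$-tuple $Y=\{y_1,\ldots,y_N\}$ of selfadjoint elements of $M$, $m,k\in\mathbb N$ and $\gamma>0$, the microstate space $\Gamma(Y;m,k,\gamma)$ is the set of all $N$-tuples $(a_1,\ldots,a_N)$ of $k\times k$ selfadjoint complex matrices such that $|tr_k(a_{i_1}\cdots a_{i_p})-\varphi(y_{i_1}\cdots y_{i_p})|<\gamma$ for all $1\le p\le m$ and $1\le i_1,\ldots,i_p\le N$, where $tr_k$ is the normalized trace. The space $(M_k^{sa}(\mathbb C))^N$ is regarded as a Euclidean space with norm $|(a_1,\ldots,a_N)|_2=(\sum_{i=1}^N tr_k(a_i^2))^{1/2}$, and $\mathrm{vol}$ is the corresponding Lebesgue measure. Free entropy: $\chi(Y;m,\gamma)=\limsup_{k\to\infty}\left[k^{-2}\log(\mathrm{vol}(\Gamma(Y;m,k,\gamma)))+N\log k\right]$ and $\chi(Y)=\inf\{\chi(Y;m,\gamma):m\in\mathbb N,\gamma>0\}$, with $\log 0=-\infty$. The union of tuples denotes the concatenated tuple, so $X\cup\{y\}$ is an $(n+1)$-tuple. *)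

(* Defs.v *)
From HB Require Import structures.
From mathcomp Require Import all_boot all_order all_algebra.
From mathcomp Require Import sesquilinear ring.
From mathcomp Require Import all_classical all_reals all_analysis.
From mathcomp Require Import complex.

Set Implicit Arguments.
Unset Strict Implicit.
Unset Printing Implicit Defensive.

Import Order.TTheory GRing.Theory Num.Theory Num.Def.
Import numFieldNormedType.Exports.

Local Open Scope classical_set_scope.
Local Open Scope ring_scope.
Local Open Scope complex_scope.

Section Operators.
Context {R : realType} {H : completeNormedModType R[i]}.
Variable ip : {dot H for conjC}.
Implicit Types (S T : H -> H) (M X : set (H -> H)) (phi : (H -> H) -> R[i]).

Definition hilbert_norm := forall x : H, `|x| ^+ 2 = ip x x.

Definition bounded_operator T :=
  linear T /\ exists C : R[i], forall x, `|T x| <= C * `|x|.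

Definition is_adjoint S T := forall x y, ip (T x) y = ip x (S y).
Definition selfadjoint T := is_adjoint T T.

Definition wot_closed M := forall T, bounded_operator T ->
  (forall n (x y : 'I_n -> H) (e : R[i]), 0 < e ->
    exists2 S, M S & forall j, `|ip (S (x j) - T (x j)) (y j)| < e) ->
  M T.

Record von_neumann_algebra M : Prop := {
  vna_bounded : forall T, M T -> bounded_operator T;
  vna_id : M idfun;
  vna_add : forall S T, M S -> M T -> M (S + T);
  vna_scale : forall (c : R[i]) T, M T -> M (c *: T);
  vna_comp : forall S T, M S -> M T -> M (S \o T);
  vna_adjoint : forall T, M T -> exists2 S, M S & is_adjoint S T;
  vna_wot_closed : wot_closed M }.

Definition vna_generated X : set (H -> H) :=
  \bigcap_(M in [set M | von_neumann_algebra M /\ X `<=` M]) M.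

Definition square_summable (xi : nat -> H) :=
  exists C : R[i], forall n, \sum_(i < n) `|xi i| ^+ 2 <= C.

(* [limn (ultraweak_sums xi eta T)] is the functional
   T |-> \sum_i <T xi_i, eta_i>; for square-summable xi, eta, their absolute
   values are the seminorms that generate the ultraweak topology *)
Definition ultraweak_sums (xi eta : nat -> H) T : nat -> R[i]^o :=
  series (fun i => ip (T (xi i)) (eta i)).

(* normality, as ultraweak continuity on M *)
Definition ultraweakly_continuous M phi :=
  forall S (e : R[i]), M S -> 0 < e ->
  exists n (xi eta : 'I_n -> nat -> H) (d : R[i]),
    [/\ forall j, square_summable (xi j) /\ square_summable (eta j), 0 < d
      & forall T, M T ->
          (forall j, `|limn (ultraweak_sums (xi j) (eta j) (T - S))| < d) ->
          `|phi T - phi S| < e].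

Record faithful_normal_tracial_state M phi : Prop := {
  state_add : forall S T, M S -> M T -> phi (S + T) = phi S + phi T;
  state_scale : forall (c : R[i]) T, M T -> phi (c *: T) = c * phi T;
  state_unital : phi idfun = 1;
  state_positive : forall S T, M S -> M T -> is_adjoint S T ->
    0 <= phi (S \o T);
  state_tracial : forall S T, M S -> M T -> phi (S \o T) = phi (T \o S);
  state_faithful : forall S T, M S -> M T -> is_adjoint S T ->
    phi (S \o T) = 0 -> T = 0;
  state_normal : ultraweakly_continuous M phi }.

End Operators.

Section FreeEntropy.
Context {R : realType} {H : completeNormedModType R[i]}.
Implicit Types (phi : (H -> H) -> R[i]).

Definition op_word {N} (Y : N.-tuple (H -> H)) (w : seq 'I_N) : H -> H :=
  foldr (fun i T => tnth Y i \o T) idfun w.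

Definition mx_word {N k} (A : N.-tuple 'M[R[i]]_k) (w : seq 'I_N) : 'M[R[i]]_k :=
  \big[mulmx/1%:M]_(i <- w) tnth A i.

Definition ntrace {k} (A : 'M[R[i]]_k) : R[i] := k%:R^-1 * \tr A.

Definition microstates phi {N} (Y : N.-tuple (H -> H)) (m k : nat) (gamma : R) :
    set (N.-tuple 'M[R[i]]_k) :=
  [set A | (forall i, tnth A i \is hermsymmx) /\
     forall w : seq 'I_N, (1 <= size w <= m)%N ->
       `|ntrace (mx_word A w) - phi (op_word Y w)| < gamma%:C].

(* Lebesgue (outer) measure on the Euclidean space R^I, for nonempty I *)
Definition lebesgue_volume {I : finType} (A : set (I -> R)) : \bar R :=
  ereal_inf [set v | exists a b : nat -> I -> R,
    [/\ forall j i, a j i <= b j i,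
        A `<=` \bigcup_j [set x | forall i, a j i <= x i <= b j i]
      & v = (\sum_(0 <= j <oo) (\prod_i (b j i - a j i))%:E)%E]].

(* Orthonormal coordinates of the space of selfadjoint k x k matrices for the
   norm (ntrace (a ^+ 2)) ^ (1/2), see [sa_mx_isometry]: the trace being
   normalized, an orthonormal basis is sqrt k times the usual one *)
Definition sa_mx {k} (x : 'I_k -> 'I_k -> R) : 'M[R[i]]_k :=
  \matrix_(p, q)
    if p == q then (Num.sqrt k%:R * x p p)%:C
    else if (p < q)%N then
      (Num.sqrt (k%:R / 2) * x p q) +i* (Num.sqrt (k%:R / 2) * x q p)
    else (Num.sqrt (k%:R / 2) * x q p) -i* (Num.sqrt (k%:R / 2) * x p q).

Definition sa_tuple {N k} (x : 'I_N * 'I_k * 'I_k -> R) :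
    N.-tuple 'M[R[i]]_k :=
  [tuple sa_mx (fun p q => x (i, p, q)) | i < N].

Definition vol {N k} (G : set (N.-tuple 'M[R[i]]_k)) : \bar R :=
  lebesgue_volume (@sa_tuple N k @^-1` G).

Definition free_entropy_at phi {N} (Y : N.-tuple (H -> H)) (m : nat) (gamma : R)
    : \bar R :=
  limn_esup (fun k : nat =>
    (k%:R ^- 2)%:E * lne (vol (@microstates phi N Y m k gamma))
    + (N%:R * ln k%:R)%:E)%E.

Definition free_entropy phi {N} (Y : N.-tuple (H -> H)) : \bar R :=
  ereal_inf [set c | exists (m : nat) (gamma : R),
    0 < gamma /\ c = free_entropy_at phi Y m gamma].

End FreeEntropy.

Section SelfadjointCoordinates.
Context {R : realType}.

Lemma sa_mx_hermsym k (x : 'I_k -> 'I_k -> R) : sa_mx x \is hermsymmx.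
Proof.
have conjE (z : R[i]) : conjC z = conjc z by [].
apply/is_hermitianmxP; rewrite expr0 scale1r; apply/matrixP => p q.
rewrite !mxE conjE -!val_eqE /=; case: (ltngtP p q) => [pq|qp|/ord_inj ->].
- by rewrite /= opprK.
- by [].
- by rewrite /= oppr0.
Qed.

Lemma sa_mx_surj k (A : 'M[R[i]]_k) : A \is hermsymmx ->
  exists x : 'I_k -> 'I_k -> R, A = sa_mx x.
Proof.
have conjE (z : R[i]) : conjC z = conjc z by [].
move=> /is_hermitianmxP; rewrite expr0 scale1r => /matrixP hA.
exists (fun p q => if p == q then complex.Re (A p p) / Num.sqrt k%:R
  else if (p < q)%N then complex.Re (A p q) / Num.sqrt (k%:R / 2)
  else complex.Im (A q p) / Num.sqrt (k%:R / 2)).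
apply/matrixP => p q; rewrite !mxE.
have k0 : 0 < k%:R :> R by rewrite ltr0n; case: k p {A hA q} => [[]|].
have s1 : Num.sqrt k%:R != 0 :> R by rewrite gt_eqF // sqrtr_gt0.
have s2 : Num.sqrt (k%:R / 2) != 0 :> R by rewrite gt_eqF // sqrtr_gt0 divr_gt0.
have := hA p q; rewrite !mxE conjE -!val_eqE /=.
case: (ltngtP p q) => [pq|qp|/ord_inj <-{q}].
- move=> _; rewrite !(mulrC (Num.sqrt _)) !divfK //.
  by case: (A p q).
- rewrite !(mulrC (Num.sqrt _)) !divfK // => ->.
  by case: (A q p).
- rewrite eqxx /= (mulrC (Num.sqrt _)) divfK //.
  case: (A p p) => a b /= [] /eqP; rewrite -subr_eq0 opprK -mulr2n mulrn_eq0 /=.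
  by move=> /eqP ->.
Qed.

Lemma sa_mx_isometry k (x : 'I_k -> 'I_k -> R) :
  ntrace (sa_mx x *m sa_mx x) = (\sum_p \sum_q x p q ^+ 2)%:C.
Proof.
case: k x => [|k] x; first by rewrite /ntrace /mxtrace !big_ord0 mulr0.
set K : R := k.+1%:R; have K0 : 0 < K by rewrite ltr0n.
have E p q : sa_mx x p q * sa_mx x q p
    = (K / 2 * x p q ^+ 2 + K / 2 * x q p ^+ 2)%:C.
  have h1 : Num.sqrt K ^+ 2 = K by rewrite sqr_sqrtr // ltW.
  have h2 : Num.sqrt (K / 2) ^+ 2 = K / 2 by rewrite sqr_sqrtr // divr_ge0 // ltW.
  rewrite !mxE -!val_eqE /= -/K.
  case: (ltngtP p q) => [pq|qp|/ord_inj <-{q}].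
  - by apply/eqP; rewrite eq_complex /=; apply/andP; split; apply/eqP; ring: h2.
  - by apply/eqP; rewrite eq_complex /=; apply/andP; split; apply/eqP; ring: h2.
  - by rewrite -rmorphM /=; congr (_%:C); rewrite -mulrDl -splitr; ring: h1.
rewrite /ntrace /mxtrace.
under eq_bigr => p _ do (rewrite mxE; under eq_bigr => q _ do rewrite E).
under eq_bigr => p _ do rewrite -rmorph_sum.
rewrite -rmorph_sum -[k.+1%:R](rmorph_nat (real_complex R)) -fmorphV -rmorphM /=.
congr (_%:C).
under eq_bigr => p _ do rewrite big_split /= -!mulr_sumr.
rewrite big_split /= -!mulr_sumr [X in _ + _ * X]exchange_big /=.
set s := (X in _ / 2 * X + _).
by rewrite -mulrDl -splitr mulrA mulVf ?mul1r // gt_eqF.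
Qed.

End SelfadjointCoordinates.

(* Main.v *)
(* Approximate y by noncommutative polynomials p in X: the projection of
   l^2(H) onto the closure of {(p(X) xi_i)_i} commutes with X, hence with y, so
   that y xi lies in this closure. As a normal state is dominated by finitely
   many vector sequences xi, this gives phi((y - p)^* (y - p)) < eps.
   If (a, b) is a microstate of (X, y) for sufficiently many moments, then
   tr((b - p(a))^* (b - p(a))) < eps as well. So a ranges over a ball of fixed
   radius while b stays at distance sqrt eps from p(a). Since p is Lipschitz on
   bounded sets, explicit boxes cover this tube with total volume at most
   (C / k)^(n k^2) (C sqrt eps / k)^(k^2), and the entropy is at most
   log (sqrt eps) plus a constant independent of eps. *)

From HB Require Import structures.
Require Import Defs.
From mathcomp Require Import all_boot all_order all_algebra.
From mathcomp Require Import sesquilinear ring lra.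
From mathcomp Require Import all_classical all_reals all_analysis.
From mathcomp Require Import complex.

Set Implicit Arguments.
Unset Strict Implicit.
Unset Printing Implicit Defensive.

Import Order.TTheory GRing.Theory Num.Theory Num.Def.
Import numFieldNormedType.Exports.

Local Open Scope classical_set_scope.
Local Open Scope ring_scope.
Local Open Scope complex_scope.

(** * Covering of tubes by boxes *)

Section Covering.
Context {R : realType}.

(** As [vol] is an infimum over countable covers by boxes, an upper bound amounts to an explicit
    cover. The work of Fubini is done by comparison with a representative: two points of the tube
    with nearly equal [a] have values of [b] at distance at most [r], so over each cell for [a] the
    coordinates of [b] are measured from one chosen point.

    Microstates bound [a] only in the normalised Hilbert-Schmidt norm, so the Lipschitz constant
    found for [p] depends on [k]. This does no harm: it only decides how fine the cells are, and the
    bound of [volume_tube] does not involve the mesh.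

    The denominators [k] come from the dimension: a ball of fixed radius in the [k ^ 2] orthonormal
    coordinates of one matrix has volume at most [(C / k) ^ (k ^ 2)]. With [n.+1] matrices these
    denominators cancel the term [N log k] of the entropy exactly, so that all terms with [0 < k]
    obey one and the same bound. *)

Lemma lebesgue_volume_finite_cover (I F : finType) (i0 : I) (A : set (I -> R))
    (a b : F -> I -> R) :
  (forall f i, a f i <= b f i) ->
  (forall x, A x -> exists f, forall i, a f i <= x i <= b f i) ->
  (lebesgue_volume A <= (\sum_f \prod_i (b f i - a f i))%:E)%E.
Proof.
move=> ab Acov.
(* From index [#|F|] on, the sequence is padded with boxes reduced to the point 0; they have volume
   0 because [i0] makes the product nonempty. *)
pose ext (c : F -> I -> R) (j : nat) : I -> R :=
  if insub j : option 'I_#|F| is Some j' then c (enum_val j') else fun=> 0.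
apply: ereal_inf_lbound; exists (ext a), (ext b); split.
- by move=> j i; rewrite /ext; case: insubP.
- move=> x /Acov [f hf]; exists (enum_rank f) => //= i.
  by rewrite /ext valK enum_rankK.
- have ge0 j : (0 <= (\prod_i (ext b j i - ext a j i))%:E)%E.
    rewrite lee_fin prodr_ge0 // => i _; rewrite subr_ge0 /ext.
    by case: insubP.
  rewrite (nneseries_split 0 #|F|); last by move=> j _; exact: ge0.
  rewrite add0n eseries0 ?adde0; last first.
    move=> j hj _; rewrite /ext insubF; last by rewrite ltnNge hj.
    by rewrite (bigD1 i0) //= subrr mul0r.
  rewrite big_mkord sumEFin; congr (_%:E).
  rewrite (reindex (@enum_val F predT)) /=; last first.
    by apply: onW_bij; exact: enum_val_bij.
  by apply: eq_bigr => j _; apply: eq_bigr => i _; rewrite /ext valK.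
Qed.

(** The quotient [m %/ L] takes each value at most [L] times, so the sum is dominated by [L] copies
    of the geometric series of sum 2. *)
Lemma sum_half_divn (L N : nat) : (0 < L)%N ->
  \sum_(m < N) (2^-1 : R) ^+ (m %/ L) <= L%:R * 2.
Proof.
move=> L0.
have h0 m : 0 <= (2^-1 : R) ^+ m by rewrite exprn_ge0 // invr_ge0.
have block K : \sum_(0 <= m < K * L) (2^-1 : R) ^+ (m %/ L)
    = L%:R * (2 - 2 * 2^-1 ^+ K).
  elim: K => [|K IH]; first by rewrite mul0n big_geq // expr0 mulr1 subrr mulr0.
  rewrite (@big_cat_nat _ _ _ (K * L)) //=; last by rewrite leq_mul2r leqnSn orbT.
  rewrite IH mulSn -[X in \sum_(X <= _ < _) _]add0n big_addn addnK.
  under eq_big_nat => m /andP[_ hm].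
    rewrite addnC divnMDl // (divn_small hm) addn0; over.
  by rewrite sumr_const_nat subn0 exprS -mulr_natl; field.
apply: (@le_trans _ _ (\sum_(0 <= m < N * L) (2^-1 : R) ^+ (m %/ L))).
  rewrite -(big_mkord predT (fun m => (2^-1 : R) ^+ (m %/ L))).
  have NL : (N <= N * L)%N by rewrite leq_pmulr.
  by rewrite (big_cat_nat (leq0n N) NL) /= lerDl sumr_ge0.
rewrite block ler_wpM2l // lerBlDr lerDl mulr_ge0 //.
Qed.

(* Each coordinate is cut into cells of length [s i / L]; the cell of [x i] is
   numbered by [m = floor (L * `|x i / s i|)] and a sign. As [m %/ L] is at most
   its square, it sums to at most [#|I|] over the coordinates. Hence weighting a
   cell by [2 ^- (m %/ L)] costs a factor [2 ^ #|I|], and makes the sum over all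
   cells factor. The coordinates outside [P] are measured from a representative
   of [S] that has the same [P]-cells. *)
Lemma volume_tube (I : finType) (i0 : I) (s : I -> R) (P : pred I)
    (S : set (I -> R)) (delta : R) :
  (forall i, 0 < s i) -> 0 < delta ->
  (forall x x', S x -> S x' -> (forall i, P i -> `|x i - x' i| <= delta) ->
    \sum_i ((if P i then x i else x i - x' i) / s i) ^+ 2 <= #|I|%:R) ->
  (lebesgue_volume S <= (8 ^+ #|I| * \prod_i s i)%:E)%E.
Proof.
move=> s0 d0 HS; set D := #|I|.
(* Fine enough for every cell to have side at most [delta]: two points in the same [P]-cells then
   satisfy the closeness condition. *)
pose L := (Num.truncn (\sum_i s i / delta)).+1.
have L0 : 0 < L%:R :> R by rewrite ltr0n.
have sL i : s i / L%:R <= delta.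
  rewrite ler_pdivrMr // mulrC -ler_pdivrMr //.
  apply: (@le_trans _ _ (\sum_i s i / delta)); last exact/ltW/truncnS_gt.
  rewrite (bigD1 i) //= lerDl sumr_ge0 // => j _.
  by rewrite divr_ge0 // ltW.
pose N := (D.+1 * L)%N.
pose code (u : R) : bool * 'I_N.+1 := (u < 0, inord (Num.truncn (L%:R * `|u|))).
pose lo (c : bool * 'I_N.+1) : R := if c.1 then - (c.2.+1%:R / L%:R) else c.2%:R / L%:R.
have codeP (u : R) : u ^+ 2 <= D%:R ->
    [/\ lo (code u) <= u <= lo (code u) + L%:R^-1
     & ((code u).2 %/ L)%:R <= u ^+ 2].
  move=> uD; set m := Num.truncn (L%:R * `|u|).
  have Lu0 : 0 <= L%:R * `|u| by rewrite mulr_ge0 // ltW.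
  have [m1 m2] := andP (truncn_itv Lu0); rewrite -/m in m1 m2.
  have qle : ((m %/ L)%:R : R) <= u ^+ 2.
    apply: (@le_trans _ _ (((m %/ L) ^ 2)%:R)).
      by rewrite ler_nat; case: (m %/ L)%N => // q; rewrite -mulnn leq_pmulr.
    rewrite natrX -[u ^+ 2]real_normK ?num_real // lerXn2r ?nnegrE //.
    rewrite -(ler_pM2l L0); apply: le_trans m1; rewrite -natrM ler_nat mulnC.
    exact: leq_trunc_div.
  have mN : (m < N.+1)%N.
    have : (m %/ L <= D)%N by rewrite -(ler_nat R); exact: le_trans qle uD.
    rewrite -ltnS -[(_ < D.+1)%N]ltnS ltnS.
    by rewrite ltn_divLR // => /ltnW.
  have h1 : m%:R / L%:R <= `|u| by rewrite ler_pdivrMr // mulrC.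
  have h2 : `|u| <= m%:R / L%:R + L%:R^-1.
    by rewrite -[X in _ + X]mul1r -mulrDl ler_pdivlMr // mulrC natr1 ltW.
  rewrite /lo /code /= inordK //; split=> //.
  rewrite -natr1 mulrDl mul1r; have [u0|u0] /= := ltP u 0.
    by rewrite ltr0_norm // in h1 h2; apply/andP; split; lra.
  by rewrite ger0_norm // in h1 h2; apply/andP; split; lra.
pose key (x : I -> R) : {ffun I -> bool * 'I_N.+1} := [ffun i => code (x i / s i)].
pose cell (f : {ffun I -> bool * 'I_N.+1}) : set (I -> R) :=
  [set x | S x /\ forall i, P i -> code (x i / s i) = f i].
(* The default 0 of [xget] is taken only on cells without a point of [S], which the covering
   argument never meets. *)
pose rep f : I -> R := xget (fun=> 0) (cell f).
pose base f i : R := if P i then 0 else rep f i.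
(* Codes violating this bound get the degenerate box at 0; the points to be covered only produce
   good codes. *)
pose good (f : {ffun I -> bool * 'I_N.+1}) := (\sum_i (f i).2 %/ L <= D)%N.
pose a f i : R := if good f then base f i + s i * lo (f i) else 0.
pose b f i : R := if good f then base f i + s i * (lo (f i) + L%:R^-1) else 0.
have sV : 0 <= \prod_i (s i / L%:R) by rewrite prodr_ge0 // => i _; rewrite divr_ge0 // ltW.
apply: (le_trans (@lebesgue_volume_finite_cover _ _ i0 S a b _ _)).
- move=> f i; rewrite /a /b; case: ifP => // _.
  by rewrite lerD2l ler_pM2l // lerDl invr_ge0 ltW.
- move=> x Sx; pose f0 := key x.
  have x0 : cell f0 x by split=> // i _; rewrite ffunE.
  have [Sr cr] : cell f0 (rep f0) by exact: (xgetPex (fun=> 0) (ex_intro _ x x0)).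
  pose x' i := x i - base f0 i; pose f := key x'.
  have x'E i : x' i = if P i then x i else x i - rep f0 i.
    by rewrite /x' /base; case: ifP; rewrite ?subr0.
  (* [f] codes the point shifted by [base f0], but [base] only reads the [P]-coordinates of a code,
     where the shift is 0; so [f] selects the same representative as [f0]. *)
  have fE : base f = base f0.
    apply/funext => i; rewrite /base; case: ifP => // _; congr (xget _ _ i).
    apply/funext => z; apply/propext.
    have E j : P j -> f j = f0 j by move=> Pj; rewrite !ffunE x'E Pj.
    by split=> -[Sz cz]; split=> // j Pj; rewrite cz // E.
  have cb z i : S z -> P i -> (z i / s i) ^+ 2 <= D%:R.
    move=> Sz Pi; apply: le_trans (HS _ _ Sz Sz _); last first.
      by move=> j _; rewrite subrr normr0 ltW.
    by rewrite (bigD1 i) //= Pi lerDl sumr_ge0 // => j _; exact: sqr_ge0.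
  have ball : \sum_i (x' i / s i) ^+ 2 <= D%:R.
    under eq_bigr do rewrite x'E.
    apply: HS => // i Pi.
    have [/andP[u1 u2] _] := codeP _ (cb _ _ Sx Pi).
    have [/andP[v1 v2] _] := codeP _ (cb _ _ Sr Pi).
    rewrite (cr i Pi) -(proj2 x0 i Pi) in v1 v2.
    apply: le_trans (sL i); rewrite -ler_pdivrMl //.
    rewrite -(gtr0_norm (s0 i)) -normfV -normrM mulrC mulrBl ler_norml.
    by apply/andP; split; lra.
  have each i : (x' i / s i) ^+ 2 <= D%:R.
    by apply: le_trans ball; rewrite (bigD1 i) //= lerDl sumr_ge0 // => j _; rewrite sqr_ge0.
  exists f => i; rewrite /a /b; have -> : good f.
    rewrite /good -(ler_nat R) natr_sum; apply: le_trans ball.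
    by apply: ler_sum => j _; rewrite ffunE; case: (codeP _ (each j)).
  rewrite fE; have [/andP[c1 c2] _] := codeP _ (each i).
  have [h1 h2] : s i * lo (f i) <= x' i /\ x' i <= s i * (lo (f i) + L%:R^-1).
    rewrite [f i]ffunE !(mulrC (s i)).
    by split; [rewrite -ler_pdivlMr | rewrite -ler_pdivrMr].
  move: h1 h2; rewrite /x' mulrDr => h1 h2.
  by apply/andP; split; lra.
rewrite lee_fin; apply: (@le_trans _ _ (\sum_(f : {ffun I -> bool * 'I_N.+1})
    \prod_i (2 * (s i / L%:R) * 2^-1 ^+ (val (f i).2 %/ L)%N))).
  apply: ler_sum => f _; rewrite /a /b; case: (boolP (good f)) => gf; last first.
    rewrite (bigD1 i0) //= subrr mul0r prodr_ge0 // => i _.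
    by rewrite !mulr_ge0 ?exprn_ge0 ?invr_ge0 // ltW.
  under eq_bigr => i _ do rewrite opprD addrACA subrr add0r -mulrBr addrC addKr.
  have -> : \prod_i (2 * (s i / L%:R) * 2^-1 ^+ (val (f i).2 %/ L)%N)
      = 2 ^+ D * 2^-1 ^+ (\sum_i (f i).2 %/ L)%N * \prod_i (s i / L%:R).
    by rewrite big_split [X in X * _ = _]big_split /= -expr_sum prodr_const mulrAC.
  rewrite -[leLHS]mul1r ler_wpM2r // exprVn ler_pdivlMr ?exprn_gt0 // mul1r.
  by rewrite ler_weXn2l // ler1n.
rewrite -(bigA_distr_bigA (fun i (c : bool * 'I_N.+1) =>
  2 * (s i / L%:R) * 2^-1 ^+ (val c.2 %/ L)%N)).
rewrite -prodr_const -big_split /=; apply: ler_prod => i _; apply/andP; split.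
  by rewrite sumr_ge0 // => c _; rewrite !mulr_ge0 ?exprn_ge0 ?invr_ge0 // ltW.
rewrite -mulr_sumr -(pair_bigA _ (fun (_ : bool) (m : 'I_N.+1) => 2^-1 ^+ (m %/ L))) /=.
rewrite big_bool /=; have := @sum_half_divn L N.+1 isT.
set w := \sum_(j < _) _ => hw.
(* This is [8 * s i]: a factor 2 from the weights, 2 from the signs and 2 from the geometric
   series. *)
apply: (@le_trans _ _ (2 * (s i / L%:R) * (L%:R * 2 + L%:R * 2))).
  by rewrite ler_wpM2l ?lerD // !mulr_ge0 ?invr_ge0 // ltW.
rewrite le_eqVlt; apply/orP; left; apply/eqP; field; exact: lt0r_neq0.
Qed.

End Covering.

(** * Orthogonal projections *)

(* Complex Hilbert spaces are handled through the real part of the inner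
   product: the orthogonal projection onto a complex subspace only depends on
   the underlying real Hilbert space. *)
Record real_hilbert_form (R : realType) (V : lmodType R[i]) (B : V -> V -> R) :
    Prop := {
  rhfDl : forall u v w, B (u + v) w = B u w + B v w;
  rhfC : forall u v, B u v = B v u;
  rhfZl : forall a u v, B (a%:C *: u) v = a * B u v;
  rhf_ge0 : forall u, 0 <= B u u;
  rhf_eq0 : forall u, B u u = 0 -> u = 0;
  rhf_complete : forall u : nat -> V,
    (forall e, 0 < e -> exists N, forall m n, (N <= m)%N -> (N <= n)%N ->
      B (u m - u n) (u m - u n) < e) ->
    exists l, forall e, 0 < e -> exists N, forall n, (N <= n)%N ->
      B (l - u n) (l - u n) < e }.

Section Projection.
Context {R : realType} {V : lmodType R[i]} {B : V -> V -> R}.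
Context (hB : real_hilbert_form B).

Definition rhf_closure (W : set V) : set V :=
  [set v | forall e, 0 < e -> exists2 w, W w & B (v - w) (v - w) < e].

Definition rhf_norm u := Num.sqrt (B u u).

Lemma rhfDr u v w : B u (v + w) = B u v + B u w.
Proof. by rewrite rhfC // rhfDl // !(rhfC hB u). Qed.

Lemma rhfZr a u v : B u (a%:C *: v) = a * B u v.
Proof. by rewrite rhfC // rhfZl // rhfC. Qed.

Lemma rhfNl u v : B (- u) v = - B u v.
Proof.
by rewrite -scaleN1r -[1 : R[i]]/(1%:C) -rmorphN /= rhfZl // mulN1r.
Qed.

Lemma rhfNr u v : B u (- v) = - B u v.
Proof. by rewrite rhfC // rhfNl // rhfC. Qed.

Definition rhfE := (rhfDl hB, rhfDr, rhfNl, rhfNr, rhfZl hB, rhfZr).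

Lemma rhf0l v : B 0 v = 0.
Proof. by rewrite -(subrr v) !rhfE subrr. Qed.

Lemma rhf_cauchy_schwarz u v : B u v ^+ 2 <= B u u * B v v.
Proof.
have [v0|v0] := eqVneq (B v v) 0.
  by rewrite (rhf_eq0 hB v0) rhfC // rhf0l expr0n mulr_ge0 ?rhf_ge0.
have vgt0 : 0 < B v v by rewrite lt0r v0 rhf_ge0.
have := rhf_ge0 hB (u - (B u v / B v v)%:C *: v).
rewrite !rhfE (rhfC hB v u) => h.
rewrite -ler_pdivrMr //.
set c := B u v / B v v in h *.
have cv : c * B v v = B u v by rewrite divfK.
rewrite cv in h; suff -> : B u v ^+ 2 / B v v = c * B u v by lra.
by rewrite expr2 mulrAC.
Qed.

Lemma rhf_normE u : rhf_norm u ^+ 2 = B u u.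
Proof. by rewrite sqr_sqrtr // rhf_ge0. Qed.

Lemma rhf_norm_ge0 u : 0 <= rhf_norm u.
Proof. exact: sqrtr_ge0. Qed.

Lemma rhf_normN u : rhf_norm (- u) = rhf_norm u.
Proof. by rewrite /rhf_norm !rhfE opprK. Qed.

Lemma rhf_normD u v : rhf_norm (u + v) <= rhf_norm u + rhf_norm v.
Proof.
rewrite -(@ler_pXn2r _ 2) // ?nnegrE ?addr_ge0 ?rhf_norm_ge0 //.
rewrite sqrrD !rhf_normE !rhfE (rhfC hB v u).
suff : B u v <= rhf_norm u * rhf_norm v by lra.
apply: (le_trans (ler_norm _)).
rewrite -(@ler_pXn2r _ 2) // ?nnegrE ?mulr_ge0 ?rhf_norm_ge0 //.
by rewrite real_normK ?num_real // exprMn !rhf_normE rhf_cauchy_schwarz.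
Qed.

Lemma rhf_norm_lt u e : 0 < e -> (rhf_norm u < e) = (B u u < e ^+ 2).
Proof.
by move=> e0; rewrite -rhf_normE ltr_pXn2r // nnegrE ?rhf_norm_ge0 // ltW.
Qed.

Lemma rhf_closureP (W : set V) v :
  rhf_closure W v <-> forall e, 0 < e -> exists2 w, W w & rhf_norm (v - w) < e.
Proof.
split=> h e e0.
  have [w Ww hw] := h _ (exprn_gt0 2 e0); exists w => //.
  by rewrite rhf_norm_lt.
have [|w Ww hw] := h (Num.sqrt e); first by rewrite sqrtr_gt0.
by exists w => //; rewrite rhf_norm_lt ?sqrtr_gt0 // sqr_sqrtr ?ltW in hw.
Qed.

Lemma rhf_min_orth r x :
  (forall t : R, B r r <= B (r - t%:C *: x) (r - t%:C *: x)) -> B r x = 0.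
Proof.
pose b := B r x; pose q := B x x => h.
have q0 : 0 <= q := rhf_ge0 hB x.
have key (t : R) : 2 * t * b <= t ^+ 2 * q.
  by have := h t; rewrite !rhfE (rhfC hB x r) -/q -/b expr2; lra.
(* The optimal [t] would be [b / q]; adding 1 avoids a case distinction on [q = 0] and still forces
   [b = 0]. *)
have := key (b / (q + 1)).
have q1 : 0 < q + 1 by lra.
have -> : 2 * (b / (q + 1)) * b = 2 * (q + 1) * (b / (q + 1)) ^+ 2.
  by field; lra.
rewrite mulrC => h1.
have : (q + 2) * (b / (q + 1)) ^+ 2 <= 0 by lra.
rewrite pmulr_rle0; last by lra.
have := sqr_ge0 (b / (q + 1)) => h2 h3.
have /eqP : (b / (q + 1)) ^+ 2 = 0 by lra.
by rewrite sqrf_eq0 mulf_eq0 invr_eq0 (gt_eqF q1) orbF => /eqP.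
Qed.

Section Subspace.
Context (W : set V).
Hypothesis W0 : W 0.
Hypothesis WD : forall u v, W u -> W v -> W (u + v).
Hypothesis WZ : forall (c : R[i]) u, W u -> W (c *: u).

Lemma rhf_closureD u v :
  rhf_closure W u -> rhf_closure W v -> rhf_closure W (u + v).
Proof.
move=> /rhf_closureP Wu /rhf_closureP Wv; apply/rhf_closureP => e e0.
have e2 : 0 < e / 2 by rewrite divr_gt0.
have [u' Wu' hu] := Wu _ e2; have [v' Wv' hv] := Wv _ e2.
exists (u' + v'); first exact: WD.
rewrite opprD addrACA; apply: le_lt_trans (rhf_normD _ _) _.
by rewrite (splitr e) ltrD.
Qed.

Lemma sub_rhf_closure w : W w -> rhf_closure W w.
Proof. by move=> Ww e e0; exists w => //; rewrite subrr rhf0l. Qed.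

Lemma rhf_closureN w : rhf_closure W w -> rhf_closure W (- w).
Proof.
move=> Ww e /Ww [w' Ww' hw]; exists (- w').
  by rewrite -scaleN1r; exact: WZ.
by rewrite -opprD rhfNl rhfNr opprK.
Qed.

Lemma rhf_closure_orth v p : rhf_closure W p ->
  (forall w, W w -> B v w = 0) -> B v p = 0.
Proof.
move=> /rhf_closureP Wp vW; apply/eqP; rewrite -normr_le0 leNgt.
apply/negP => h.
have [|w Ww hw] := Wp (`|B v p| / (rhf_norm v + 1)).
  by rewrite divr_gt0 // ltr_wpDl // rhf_norm_ge0.
move: hw; rewrite ltr_pdivlMr; last by rewrite ltr_wpDl // rhf_norm_ge0.
apply/negP; rewrite -leNgt.
have -> : B v p = B v (p - w) by rewrite !rhfE (vW w) // subr0.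
apply: (@le_trans _ _ (rhf_norm (p - w) * rhf_norm v)); last first.
  by rewrite ler_wpM2l ?rhf_norm_ge0 // lerDl.
rewrite -(@ler_pXn2r _ 2) // ?nnegrE ?mulr_ge0 ?rhf_norm_ge0 //.
by rewrite real_normK ?num_real // exprMn !rhf_normE mulrC rhf_cauchy_schwarz.
Qed.

(** A minimising sequence in [W] converges by completeness; its limit is the point of the closure of
    [W] nearest to [v]. *)
Lemma rhf_projection_exists v :
  exists p, rhf_closure W p /\ forall w, W w -> B (v - p) w = 0.
Proof.
pose E := [set B (v - w) (v - w) | w in W].
pose d := inf E.
have Einf : has_inf E.
  split; first by exists (B (v - 0) (v - 0)); exists 0.
  by exists 0 => _ [w _ <-]; exact: rhf_ge0.
have dle w : W w -> d <= B (v - w) (v - w).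
  by move=> Ww; apply: ge_inf; [exact: Einf.2|exists w].
have d0 : 0 <= d by apply: lb_le_inf; [exact: Einf.1|move=> _ [w _ <-]; exact: rhf_ge0].
have wex n : exists w, W w /\ B (v - w) (v - w) < d + n.+1%:R^-1.
  have [|_ [w Ww <-] hw] := inf_adherent (eps := n.+1%:R^-1) _ Einf.
    by rewrite invr_gt0.
  by exists w.
pose w n := projT1 (cid (wex n)).
have wP n : W (w n) /\ B (v - w n) (v - w n) < d + n.+1%:R^-1.
  exact: (projT2 (cid (wex n))).
(* Parallelogram identity: the midpoint of [w m] and [w n] lies in [W], hence at squared distance at
   least [d] from [v]. *)
have cau m n : B (w m - w n) (w m - w n) <= 2 * (m.+1%:R^-1 + n.+1%:R^-1).
  have [Wm hm] := wP m; have [Wn hn] := wP n.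
  have := dle _ (WZ (2^-1)%:C (WD Wm Wn)).
  move: hm hn; rewrite !rhfE !(rhfC hB (w _) v) (rhfC hB (w n) (w m)) => hm hn.
  by move: (m.+1%:R^-1) (n.+1%:R^-1) hm hn => x y hm hn h; lra.
have [] := rhf_complete hB (u := w).
  move=> e e0; exists (Num.truncn (4 / e)) => m n hm hn.
  apply: le_lt_trans (cau _ _) _.
  have inv k : (Num.truncn (4 / e) <= k)%N -> k.+1%:R^-1 < e / 4.
    move=> hk; rewrite -[e / 4]invrK ltf_pV2 ?posrE ?invr_gt0 ?divr_gt0 //.
    rewrite invf_div; apply: (lt_le_trans (truncnS_gt _)).
    by rewrite ler_nat.
  by move: (m.+1%:R^-1) (n.+1%:R^-1) (inv _ hm) (inv _ hn) => x y; lra.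
move=> p hp; exists p.
have Wp : rhf_closure W p.
  move=> e /hp [N hN]; exists (w N); [by case: (wP N)|exact: hN].
split=> // x Wx.
(* Minimality passes to the closure, where the competitors [p + t x] needed for [rhf_min_orth]
   lie. *)
have low z : rhf_closure W z -> d <= B (v - z) (v - z).
  move=> /rhf_closureP Wz; rewrite -rhf_normE -[d]sqr_sqrtr //.
  rewrite ler_pXn2r ?nnegrE ?sqrtr_ge0 //.
  apply/ler_addgt0Pr => e /Wz [z' Wz' hz].
  apply: (@le_trans _ _ (rhf_norm (v - z'))).
    by rewrite /rhf_norm ler_sqrt ?rhf_ge0 // dle.
  rewrite -(subrKA z v) (le_trans (rhf_normD _ _)) // lerD2l.
  exact: ltW.
have up : B (v - p) (v - p) <= d.
  rewrite -rhf_normE -[leRHS]sqr_sqrtr // ler_pXn2r ?nnegrE ?sqrtr_ge0 //.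
  apply/ler_addgt0Pr => e e0.
  have eh : 0 <= e / 2 by rewrite divr_ge0 // ltW.
  have e2 : 0 < (e / 2) ^+ 2 by rewrite exprn_gt0 // divr_gt0.
  have [N1 hN1] := hp _ e2.
  pose n := maxn N1 (Num.truncn (((e / 2) ^+ 2)^-1)).
  have h1 : rhf_norm (p - w n) < e / 2.
    by rewrite rhf_norm_lt ?divr_gt0 //; apply: hN1; rewrite leq_maxl.
  have h2 : rhf_norm (v - w n) <= Num.sqrt d + e / 2.
    rewrite -(@ler_pXn2r _ 2) // ?nnegrE ?rhf_norm_ge0 ?addr_ge0 ?sqrtr_ge0 //.
    rewrite rhf_normE; apply: (le_trans (ltW (proj2 (wP n)))).
    rewrite sqrrD sqr_sqrtr // -addrA lerD2l.
    apply: (@le_trans _ _ ((e / 2) ^+ 2)); last first.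
      by rewrite lerDr mulrn_wge0 // mulr_ge0 ?sqrtr_ge0.
    rewrite -[leRHS]invrK lef_pV2 ?posrE ?invr_gt0 //.
    apply: (le_trans (ltW (truncnS_gt _))).
    by rewrite ler_nat ltnS leq_maxr.
  rewrite -(subrKA (w n) v) (le_trans (rhf_normD _ _)) //.
  rewrite -[rhf_norm (w n - p)]rhf_normN opprB; lra.
apply: rhf_min_orth => t; rewrite -addrA -opprD; apply: (le_trans up).
by apply/low/rhf_closureD => //; exact/sub_rhf_closure/WZ.
Qed.

Definition rhf_proj v := projT1 (cid (rhf_projection_exists v)).

Lemma rhf_proj_closure v : rhf_closure W (rhf_proj v).
Proof. by case: (projT2 (cid (rhf_projection_exists v))). Qed.

Lemma rhf_proj_orth v w : rhf_closure W w -> B (v - rhf_proj v) w = 0.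
Proof.
move=> Ww; apply: rhf_closure_orth Ww _.
by case: (projT2 (cid (rhf_projection_exists v))).
Qed.

Lemma rhf_proj_uniq v p : rhf_closure W p ->
  (forall w, W w -> B (v - p) w = 0) -> rhf_proj v = p.
Proof.
move=> Wp vp; apply/eqP; rewrite -subr_eq0; apply/eqP.
apply: (rhf_eq0 hB); set z := _ - p.
have Wz : rhf_closure W z.
  by apply: rhf_closureD; [exact: rhf_proj_closure|exact: rhf_closureN].
have -> : B z z = B (v - p) z - B (v - rhf_proj v) z.
  by rewrite -rhfNl -rhfDl // opprB addrC subrKA.
by rewrite rhf_proj_orth // (rhf_closure_orth Wz) // subrr.
Qed.

Lemma rhf_proj_id w : W w -> rhf_proj w = w.
Proof.
move=> Ww; apply: rhf_proj_uniq; first exact: sub_rhf_closure.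
by move=> x _; rewrite subrr rhf0l.
Qed.

Lemma rhf_projD u v : rhf_proj (u + v) = rhf_proj u + rhf_proj v.
Proof.
apply: rhf_proj_uniq.
  by apply: rhf_closureD; exact: rhf_proj_closure.
move=> w /sub_rhf_closure Ww.
by rewrite opprD addrACA rhfDl // !rhf_proj_orth // addr0.
Qed.

Lemma rhf_projN u : rhf_proj (- u) = - rhf_proj u.
Proof.
apply: rhf_proj_uniq; first exact/rhf_closureN/rhf_proj_closure.
by move=> w /sub_rhf_closure Ww; rewrite -opprD rhfNl rhf_proj_orth ?oppr0.
Qed.

Lemma rhf_proj_sym u v : B (rhf_proj u) v = B u (rhf_proj v).
Proof.
have h x y : B (rhf_proj x) y = B (rhf_proj x) (rhf_proj y).
  apply/eqP; rewrite -subr_eq0 -rhfNr -rhfDr (rhfC hB) rhf_proj_orth //.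
  exact: rhf_proj_closure.
by rewrite h rhfC // -h rhfC.
Qed.

Lemma rhf_proj_le u : rhf_norm (rhf_proj u) <= rhf_norm u.
Proof.
rewrite -(@ler_pXn2r _ 2) // ?nnegrE ?rhf_norm_ge0 // !rhf_normE.
have := rhf_ge0 hB (u - rhf_proj u).
have /eqP := rhf_proj_orth u (rhf_proj_closure u).
rewrite !rhfE subr_eq0 (rhfC hB (rhf_proj u) u) => /eqP <-.
by rewrite subrr subr0 subr_ge0.
Qed.

(** Invariance of [W] under [T] keeps [T (rhf_proj v)] in the closure; invariance under the adjoint
    [T'] keeps [T (v - rhf_proj v)] orthogonal to [W]. It serves for operators and for complex
    scalars alike. *)
Lemma rhf_proj_comm (T T' : V -> V) (K : R) :
  (forall u v, T (u - v) = T u - T v) ->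
  (forall u, rhf_norm (T u) <= K * rhf_norm u) ->
  (forall u v, B (T u) v = B u (T' v)) ->
  (forall w, W w -> W (T w)) -> (forall w, W w -> W (T' w)) ->
  forall v, rhf_proj (T v) = T (rhf_proj v).
Proof.
move=> TB Tbd TT' WT WT' v; apply: rhf_proj_uniq.
  apply/rhf_closureP => e e0.
  have K0 : 0 < `|K| + 1 by rewrite ltr_wpDl.
  have [w Ww hw] := (rhf_closureP _ _).1 (rhf_proj_closure v) _ (divr_gt0 e0 K0).
  exists (T w); first exact: WT.
  rewrite -TB (le_lt_trans (Tbd _)) //.
  rewrite (@le_lt_trans _ _ ((`|K| + 1) * rhf_norm (rhf_proj v - w))) //.
    by rewrite ler_wpM2r ?rhf_norm_ge0 // (le_trans (ler_norm _)) // lerDl.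
  by rewrite mulrC -ltr_pdivlMr.
move=> w Ww; rewrite -TB TT' rhf_proj_orth //.
exact/sub_rhf_closure/WT'.
Qed.

End Subspace.
End Projection.

(** * Square-summable sequences *)

Section SquareSummable.
Context {R : realType} {H : completeNormedModType R[i]}.
Context {ip : {dot H for Num.conj}} (hip : hilbert_norm ip).

Definition rnorm (x : H) : R := complex.Re `|x|.
Definition rip (x y : H) : R := complex.Re (ip x y).

Lemma rnormE x : `|x| = (rnorm x)%:C.
Proof. by rewrite /rnorm RRe_real // ger0_real. Qed.

Lemma rnorm_ge0 x : 0 <= rnorm x.
Proof. by rewrite -lecR -rnormE normr_ge0. Qed.

Lemma ripxx x : rip x x = rnorm x ^+ 2.
Proof. by rewrite /rip -hip rnormE -rmorphXn. Qed.

Lemma conjCE (z : R[i]) : Num.conj z = conjc z. Proof. by []. Qed.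

Lemma Re_conjc (z : R[i]) : complex.Re (conjc z) = complex.Re z.
Proof. by case: z. Qed.

Lemma ipC x y : ip x y = conjc (ip y x).
Proof. by have := hermC ip x y; rewrite expr0 mul1r. Qed.

Lemma ipDl x y z : ip (x + y) z = ip x z + ip y z.
Proof. by rewrite linearDl. Qed.

Lemma ipZl c x z : ip (c *: x) z = c * ip x z.
Proof. by rewrite linearZl_LR. Qed.

Lemma ipZr c x z : ip x (c *: z) = conjc c * ip x z.
Proof. by rewrite linearZr_LR. Qed.

Lemma ripC x y : rip x y = rip y x.
Proof. by rewrite /rip ipC Re_conjc. Qed.

Lemma rip_conj c x y : rip (c *: x) y = rip x (conjc c *: y).
Proof. by rewrite /rip ipZl ipZr conjcK. Qed.

Lemma rip_ext x y : (forall z, rip x z = rip y z) -> x = y.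
Proof.
move=> h; apply/eqP; rewrite -subr_eq0 -normr_eq0 rnormE; apply/eqP.
have : rip (x - y) (x - y) = 0.
  rewrite /rip ipDl -scaleN1r ipZl mulN1r raddfB /= -/(rip _ _) -/(rip _ _) h.
  by rewrite subrr.
by rewrite ripxx => /eqP; rewrite sqrf_eq0 => /eqP ->.
Qed.

Lemma ip_Im x y : complex.Im (ip x y) = rip x ('i *: y).
Proof.
rewrite /rip ipZr; case: (ip x y) => a b /=; ring.
Qed.

Lemma complex_gt0 (e : R[i]) : 0 < e -> exists2 r : R, 0 < r & e = r%:C.
Proof.
case: e => a b; rewrite ltcE /= => /andP[/eqP -> a0]; by exists a.
Qed.

Lemma H_real_hilbert : real_hilbert_form rip.
Proof.
split.
- by move=> u v w; rewrite /rip ipDl raddfD.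
- exact: ripC.
- by move=> a u v; rewrite /rip ipZl; case: (ip u v) => p q /=; ring.
- by move=> u; rewrite ripxx sqr_ge0.
- move=> u; rewrite ripxx => /eqP; rewrite sqrf_eq0 => /eqP h.
  by apply/eqP; rewrite -normr_eq0 rnormE h.
- move=> u cu.
  have near e : 0 < e -> exists N, forall m n, (N <= m)%N -> (N <= n)%N ->
      `|u m - u n| < e.
    move=> /complex_gt0[r r0 ->]; have [|N hN] := cu (r ^+ 2).
      by rewrite exprn_gt0.
    exists N => m n hm hn; have := hN _ _ hm hn.
    by rewrite ripxx rnormE ltcR ltr_pXn2r // nnegrE ?rnorm_ge0 // ltW.
  have uc : cauchy (u @ \oo).
    apply/cauchy_exP => e /near [N hN].
    exists (u N); exists N => // n /= hn.
    by rewrite -ball_normE /=; exact: hN.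
  have ul := (cvgrPdist_lt _ _).1 (@cauchy_cvg H (u @ \oo) _ uc).
  exists (lim (u @ \oo)) => e e0.
  have [|N _ hN] := ul _ _ (Num.sqrt e)%:C; first by rewrite ltcR sqrtr_gt0.
  exists N => n /hN /=.
  rewrite ripxx rnormE ltcR -[e in _ -> _ < e]sqr_sqrtr ?ltW // => h.
  by rewrite ltr_pXn2r // nnegrE ?rnorm_ge0 ?sqrtr_ge0.
Qed.

Lemma rnorm_parallelogram x y :
  rnorm (x + y) ^+ 2 + rnorm (x - y) ^+ 2 = 2 * rnorm x ^+ 2 + 2 * rnorm y ^+ 2.
Proof. by rewrite -!ripxx !(rhfE H_real_hilbert) !(ripC y x); ring. Qed.

Lemma square_summableP (xi : nat -> H) : square_summable xi <->
  exists C : R, forall n, \sum_(i < n) rnorm (xi i) ^+ 2 <= C.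
Proof.
have E n : \sum_(i < n) `|xi i| ^+ 2 = (\sum_(i < n) rnorm (xi i) ^+ 2)%:C.
  by rewrite rmorph_sum; apply: eq_bigr => i _; rewrite rnormE -rmorphXn.
split=> -[C hC]; last by exists C%:C => n; rewrite E lecR.
by exists (complex.Re C) => n; have := hC n; rewrite E lecE => /andP[].
Qed.

Definition l2_pred : pred (nat -> H) := fun xi => `[< square_summable xi >].

Lemma l2_submod_closed : submod_closed l2_pred.
Proof.
split.
  apply/asboolP/square_summableP; exists 0 => n.
  by rewrite big1 // => i _; rewrite /rnorm normr0 expr0n.
move=> c u v /asboolP/square_summableP[A hA] /asboolP/square_summableP[B hB].
apply/asboolP/square_summableP.
pose k := complex.Re `|c|; have kE : `|c| = k%:C by rewrite RRe_real // ger0_real.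
exists (2 * k ^+ 2 * A + 2 * B) => n.
apply: (@le_trans _ _ (\sum_(i < n) (2 * k ^+ 2 * rnorm (u i) ^+ 2 + 2 * rnorm (v i) ^+ 2))).
  apply: ler_sum => i _.
  have cu : rnorm (c *: u i) = k * rnorm (u i).
    by rewrite /rnorm normrZ kE rnormE -rmorphM.
  have k0 : 0 <= k by rewrite -ler0c -kE.
  have : rnorm (c *: u i + v i) <= k * rnorm (u i) + rnorm (v i).
    by rewrite -cu -lecR rmorphD /= -!rnormE ler_normD.
  move: (rnorm_ge0 (u i)) (rnorm_ge0 (v i)) (rnorm_ge0 (c *: u i + v i)).
  rewrite -[(c *: u + v) i]/(c *: u i + v i).
  move: (rnorm (u i)) (rnorm (v i)) (rnorm (c *: u i + v i)) => p q r p0 q0 r0 h.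
  apply: (@le_trans _ _ ((k * p + q) ^+ 2)).
  rewrite ler_pXn2r ?nnegrE ?addr_ge0 ?mulr_ge0 //. 
  rewrite -mulrA -exprMn; have := sqr_ge0 (k * p - q).
  by move: (k * p) => t; nra.
rewrite big_split -!mulr_sumr lerD // ler_wpM2l //.
by rewrite mulr_ge0 // sqr_ge0.
Qed.

HB.instance Definition _ := GRing.isSubmodClosed.Build _ _ l2_pred l2_submod_closed.

Record l2 := L2 { l2_val :> nat -> H; l2_valP : l2_val \in l2_pred }.
HB.instance Definition _ := [isSub for l2_val].
HB.instance Definition _ := [Choice of l2 by <:].
HB.instance Definition _ := [SubChoice_isSubLmodule of l2 by <:].

Implicit Types u v w : l2.

Lemma l2_summable u : exists C : R, forall n, \sum_(i < n) rnorm (u i) ^+ 2 <= C.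
Proof. exact/square_summableP/asboolP/(l2_valP u). Qed.

Lemma l2_valD u v i : (u + v) i = u i + v i. Proof. by []. Qed.
Lemma l2_valB u v i : (u - v) i = u i - v i. Proof. by []. Qed.
Lemma l2_valZ c u i : (c *: u) i = c *: u i. Proof. by []. Qed.

Definition l2_sums u v (n : nat) : R := \sum_(i < n) rip (u i) (v i).

Definition l2_form u v : R := limn (l2_sums u v).

Lemma l2_sums_nd u : {homo l2_sums u u : n m / (n <= m)%N >-> n <= m}.
Proof.
apply/nondecreasing_seqP => n; rewrite /l2_sums big_ord_recr /= lerDl.
by rewrite ripxx sqr_ge0.
Qed.

Lemma l2_sums_cvg_diag u : cvgn (l2_sums u u).
Proof.
apply: nondecreasing_is_cvgn; first exact: l2_sums_nd.
have [C hC] := l2_summable u; exists C => _ [n _ <-].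
by apply: le_trans (hC n); rewrite le_eqVlt /l2_sums; under eq_bigr do rewrite ripxx; rewrite eqxx.
Qed.

(** Polarisation expresses the mixed partial sums through diagonal ones, which are nondecreasing and
    bounded. *)
Lemma l2_sums_cvg u v : l2_sums u v @ \oo --> l2_form u v.
Proof.
suff : cvgn (l2_sums u v) by [].
have -> : l2_sums u v = (fun n => 4^-1 *
    (l2_sums (u + v) (u + v) n - l2_sums (u - v) (u - v) n)).
  apply/funext => n; rewrite /l2_sums -sumrB mulr_sumr; apply: eq_bigr => i _.
  by rewrite l2_valD l2_valB !(rhfE H_real_hilbert) (ripC (v i)); field.
apply: is_cvgM; first exact: is_cvg_cst.
by apply: is_cvgB; exact: l2_sums_cvg_diag.
Qed.

Lemma l2_form_uniq u v (l : R) : l2_sums u v @ \oo --> l -> l2_form u v = l.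
Proof. by move=> h; apply/cvg_lim. Qed.

Lemma l2_sums_le u n : l2_sums u u n <= l2_form u u.
Proof.
apply: nondecreasing_cvgn_le; [exact: l2_sums_nd|exact: l2_sums_cvg_diag].
Qed.

Lemma l2_form_le u C : (forall n, \sum_(i < n) rnorm (u i) ^+ 2 <= C) ->
  l2_form u u <= C.
Proof.
move=> h; apply: limr_le; first exact: l2_sums_cvg_diag.
by apply: nearW => n; rewrite /l2_sums; under eq_bigr do rewrite ripxx.
Qed.

Lemma sum_rnorm_le u n : \sum_(i < n) rnorm (u i) ^+ 2 <= l2_form u u.
Proof.
by have := l2_sums_le u n; rewrite /l2_sums; under eq_bigr do rewrite ripxx.
Qed.

Lemma l2_coord_le u i : rnorm (u i) ^+ 2 <= l2_form u u.
Proof.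
apply: le_trans (sum_rnorm_le u i.+1); rewrite big_ord_recr /= lerDr.
by rewrite sumr_ge0 // => j _; exact: sqr_ge0.
Qed.

Lemma l2_form_ge0 u : 0 <= l2_form u u.
Proof. exact: le_trans (sqr_ge0 _) (l2_coord_le u 0). Qed.

Lemma l2_formDl u v w : l2_form (u + v) w = l2_form u w + l2_form v w.
Proof.
apply: l2_form_uniq.
have -> : l2_sums (u + v) w = (fun n => l2_sums u w n + l2_sums v w n).
  apply/funext => n; rewrite /l2_sums -big_split /=; apply: eq_bigr => i _.
  by rewrite !(rhfE H_real_hilbert).
by apply: cvgD; exact: l2_sums_cvg.
Qed.

Lemma l2_formC u v : l2_form u v = l2_form v u.
Proof.
by congr (limn _); apply/funext => n; apply: eq_bigr => i _; rewrite ripC.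
Qed.

Lemma l2_formZ a u v : l2_form (a%:C *: u) v = a * l2_form u v.
Proof.
apply: l2_form_uniq.
have -> : l2_sums (a%:C *: u) v = (fun n => a * l2_sums u v n).
  apply/funext => n; rewrite /l2_sums mulr_sumr; apply: eq_bigr => i _.
  by rewrite l2_valZ !(rhfE H_real_hilbert).
by apply: cvgM; [exact: cvg_cst|exact: l2_sums_cvg].
Qed.

Lemma l2_form_eq0 u : l2_form u u = 0 -> u = 0.
Proof.
move=> h; apply/val_inj/funext => i /=; apply/eqP.
rewrite -normr_eq0 rnormE; have := l2_coord_le u i; rewrite h => h'.
have /eqP : rnorm (u i) ^+ 2 = 0 by apply/le_anti; rewrite h' sqr_ge0.
by rewrite sqrf_eq0 => /eqP ->.
Qed.

Lemma l2_complete (u : nat -> l2) :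
  (forall e, 0 < e -> exists N, forall m n, (N <= m)%N -> (N <= n)%N ->
    l2_form (u m - u n) (u m - u n) < e) ->
  exists l, forall e, 0 < e -> exists N, forall n, (N <= n)%N ->
    l2_form (l - u n) (l - u n) < e.
Proof.
move=> cu.
have coord i : exists l : H, forall e, 0 < e -> exists N, forall n, (N <= n)%N ->
    rnorm (l - u n i) ^+ 2 < e.
  have [|l hl] := rhf_complete H_real_hilbert (u := fun n => u n i).
    move=> e /cu [N hN]; exists N => m n hm hn; rewrite ripxx.
    exact: le_lt_trans (l2_coord_le _ i) (hN _ _ hm hn).
  exists l => e /hl [N hN]; exists N => n hn; rewrite -ripxx; exact: hN.
pose l i := projT1 (cid (coord i)).
have lP i e : 0 < e -> exists N, forall n, (N <= n)%N -> rnorm (l i - u n i) ^+ 2 < e.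
  exact: (projT2 (cid (coord i))).
have lub e : 0 < e -> exists N, forall n, (N <= n)%N -> forall r,
    \sum_(i < r) rnorm (l i - u n i) ^+ 2 <= e.
  move=> e0; have e4 : 0 < e / 4 by rewrite divr_gt0.
  have [N hN] := cu _ e4; exists N => n hn r.
  (* One index [m] serves the first [r] coordinates; it depends on [r], but the resulting bound on
     the partial sum does not. *)
  have [m [hm sm]] : exists m, (N <= m)%N /\
      \sum_(i < r) rnorm (l i - u m i) ^+ 2 <= e / 4.
    have er : 0 < e / 4 / r.+1%:R by rewrite divr_gt0.
    pose f i := projT1 (cid (lP i _ er)).
    have fP i : forall n, (f i <= n)%N -> rnorm (l i - u n i) ^+ 2 < e / 4 / r.+1%:R.
      exact: (projT2 (cid (lP i _ er))).
    exists (maxn N (\max_(i < r) f i)); split; first exact: leq_maxl.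
    apply: (@le_trans _ _ (\sum_(i < r) (e / 4 / r.+1%:R))).
      apply: ler_sum => i _; apply/ltW/fP/(leq_trans _ (leq_maxr _ _)).
      exact: (leq_bigmax i).
    rewrite sumr_const card_ord -[leLHS]mulr_natr mulrAC ler_pdivrMr //.
    by rewrite ler_pM2l // ler_nat.
  apply: (@le_trans _ _ (\sum_(i < r) (2 * rnorm (l i - u m i) ^+ 2
      + 2 * rnorm (u m i - u n i) ^+ 2))).
    apply: ler_sum => i _; rewrite -rnorm_parallelogram.
    by rewrite addrA subrK lerDl sqr_ge0.
  rewrite big_split -!mulr_sumr /=.
  have := sum_rnorm_le (u m - u n) r; have := hN _ _ hm hn.
  set s := \sum_(i < r) rnorm ((u m - u n) i) ^+ 2.
  rewrite -/s; lra.
have lS : l \in l2_pred.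
  have [N hN] := lub _ ltr01.
  have -> : l = (l - u N) + u N by rewrite subrK.
  apply: rpredD; last exact: l2_valP.
  by apply/asboolP/square_summableP; exists 1; exact: hN.
exists (L2 lS) => e e0; have e2 : 0 < e / 2 by rewrite divr_gt0.
have [N hN] := lub _ e2; exists N => n /hN h.
apply: (@le_lt_trans _ _ (e / 2)); first exact: l2_form_le.
by rewrite ltr_pdivrMr // ltr_pMr // ltr1n.
Qed.

Lemma l2_real_hilbert : real_hilbert_form l2_form.
Proof.
split; [exact: l2_formDl|exact: l2_formC|exact: l2_formZ|exact: l2_form_ge0
  |exact: l2_form_eq0|exact: l2_complete].
Qed.

Lemma l2_delta_subproof (j : nat) (x : H) :
  (fun i => if i == j then x else 0) \in l2_pred.
Proof.
apply/asboolP/square_summableP; exists (rnorm x ^+ 2) => n.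
have E i : rnorm (if i == j then x else 0) ^+ 2 = if i == j then rnorm x ^+ 2 else 0.
  by case: eqP => // _; rewrite /rnorm normr0 expr0n.
under eq_bigr do rewrite E; rewrite -big_mkcond /=.
have [jn|nj] := ltnP j n; last first.
  rewrite big1 ?sqr_ge0 // => i /eqP ij.
  by have := ltn_ord i; rewrite ij ltnNge nj.
by rewrite (big_pred1 (Ordinal jn)).
Qed.

Definition l2_delta j x : l2 := L2 (l2_delta_subproof j x).

Lemma l2_deltaE j x i : l2_delta j x i = if i == j then x else 0.
Proof. by []. Qed.

Lemma l2_form_delta j x u : l2_form (l2_delta j x) u = rip x (u j).
Proof.
apply: l2_form_uniq; apply: cvg_near_cst; exists j.+1 => // n /= jn.
rewrite /l2_sums (bigD1 (Ordinal jn)) //= eqxx big1 ?addr0 // => i ij.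
by rewrite ifN ?(rhf0l H_real_hilbert).
Qed.

Definition l2_trunc u n : l2 := \sum_(j < n) l2_delta j (u j).

Lemma l2_truncE u n i : l2_trunc u n i = if (i < n)%N then u i else 0.
Proof.
elim: n => [|n IH]; first by rewrite /l2_trunc big_ord0.
rewrite /l2_trunc big_ord_recr -/(l2_trunc u n) l2_valD IH l2_deltaE ltnS /=.
by case: ltngtP => [||->]; rewrite ?addr0 ?add0r.
Qed.

Lemma l2_form_sum I (r : seq I) (F : I -> l2) u :
  l2_form (\sum_(j <- r) F j) u = \sum_(j <- r) l2_form (F j) u.
Proof.
elim/big_rec2: _ => [|j a v _ IH]; last by rewrite l2_formDl IH.
exact: (rhf0l l2_real_hilbert).
Qed.

(** The squared norm of the tail is the form minus its partial sum. *)
Lemma l2_trunc_cvg u e : 0 < e ->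
  exists n, l2_form (u - l2_trunc u n) (u - l2_trunc u n) < e.
Proof.
move=> e0.
have /cvgrPdist_lt/(_ e e0)[N _ hN] := @l2_sums_cvg u u.
exists N; have := hN N (leqnn N) => /=; rewrite ltr_norml => /andP[_ h].
apply: le_lt_trans h; rewrite !(rhfE l2_real_hilbert) (l2_formC u).
have E v : l2_form (l2_trunc u N) v = l2_sums u v N.
  by rewrite l2_form_sum; apply: eq_bigr => j _; rewrite l2_form_delta.
rewrite !E; have -> : l2_sums u (l2_trunc u N) N = l2_sums u u N.
  by apply: eq_bigr => j _; rewrite l2_truncE ltn_ord.
by rewrite opprK addNr addr0.
Qed.

Lemma bounded_rnorm (T : H -> H) : bounded_operator T ->
  exists2 K : R, 0 <= K & forall x, rnorm (T x) <= K * rnorm x.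
Proof.
move=> [_ [C hC]]; exists `|complex.Re C| => // x.
have := hC x; rewrite !rnormE lecE => /andP[_ /=]; case: C {hC} => a b /=.
rewrite mulr0 subr0 => /le_trans -> //.
by rewrite ler_wpM2r ?rnorm_ge0 // ler_norm.
Qed.

Lemma l2_map_subproof (T : H -> H) (bT : bounded_operator T) (u : l2) :
  (fun i => T (u i)) \in l2_pred.
Proof.
have [K K0 hK] := bounded_rnorm bT.
have [C hC] := l2_summable u.
apply/asboolP/square_summableP; exists (K ^+ 2 * C) => n.
apply: (@le_trans _ _ (\sum_(i < n) K ^+ 2 * rnorm (u i) ^+ 2)).
  apply: ler_sum => i _; rewrite -exprMn.
  by rewrite ler_pXn2r // nnegrE ?mulr_ge0 ?rnorm_ge0.
by rewrite -mulr_sumr ler_wpM2l // sqr_ge0.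
Qed.

(** The amplification of [T] to the Hilbert sum of countably many copies of [H]. *)
Definition l2_map T bT u : l2 := L2 (@l2_map_subproof T bT u).

Lemma l2_mapE T (bT : bounded_operator T) u i : l2_map bT u i = T (u i).
Proof. by []. Qed.

Lemma l2_map_bounded T (bT : bounded_operator T) :
  exists2 K : R, 0 <= K & forall u, rhf_norm (B := l2_form) (l2_map bT u)
    <= K * rhf_norm (B := l2_form) u.
Proof.
have [K K0 hK] := bounded_rnorm bT; exists K => // u.
rewrite -(@ler_pXn2r _ 2) // ?nnegrE ?mulr_ge0 ?rhf_norm_ge0 //.
rewrite exprMn !(rhf_normE l2_real_hilbert); apply: l2_form_le => n.
apply: (@le_trans _ _ (\sum_(i < n) K ^+ 2 * rnorm (u i) ^+ 2)).
  apply: ler_sum => i _; rewrite -exprMn.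
  by rewrite ler_pXn2r ?nnegrE ?mulr_ge0 ?rnorm_ge0 //; exact: hK.
by rewrite -mulr_sumr ler_wpM2l ?sqr_ge0 // sum_rnorm_le.
Qed.

Lemma bounded_linearB T (u v : H) : bounded_operator (H := H) T -> T (u - v) = T u - T v.
Proof.
by move=> [lT _]; rewrite addrC -scaleN1r lT scaleN1r addrC.
Qed.

Lemma bounded_linear0 T : bounded_operator (H := H) T -> T 0 = 0.
Proof. by move=> bT; have := bounded_linearB 0 0 bT; rewrite !subrr. Qed.

Lemma bounded_linearD T (u v : H) : bounded_operator (H := H) T -> T (u + v) = T u + T v.
Proof. by move=> [lT _]; rewrite -[u]scale1r lT !scale1r. Qed.

Lemma bounded_linearZ T c (u : H) : bounded_operator (H := H) T -> T (c *: u) = c *: T u.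
Proof. by move=> bT; rewrite -[c *: u]addr0 bT.1 bounded_linear0 // addr0. Qed.

Lemma l2_mapB T (bT : bounded_operator T) u v :
  l2_map bT (u - v) = l2_map bT u - l2_map bT v.
Proof. by apply/val_inj/funext => i /=; exact: bounded_linearB. Qed.

Lemma l2_map_delta T (bT : bounded_operator T) j x :
  l2_map bT (l2_delta j x) = l2_delta j (T x).
Proof.
by apply/val_inj/funext => i /=; case: eqP => // _; exact: bounded_linear0.
Qed.

Lemma l2_map_adjoint S T (bS : bounded_operator S) (bT : bounded_operator T) u v :
  is_adjoint ip S T -> l2_form (l2_map bT u) v = l2_form u (l2_map bS v).
Proof.
move=> ST; congr (limn _); apply/funext => n; apply: eq_bigr => i _.
by rewrite /rip /= ST.
Qed.

End SquareSummable.

(** * Ultrastrong density of polynomials *)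

Section OperatorPolynomials.
Context {R : realType} {H : completeNormedModType R[i]} {n : nat}.
Implicit Types (X : n.-tuple (H -> H)) (p : seq (R[i] * seq 'I_n)).

Definition op_poly X p : H -> H := \sum_(t <- p) t.1 *: op_word X t.2.

Lemma op_poly_cons X t p : op_poly X (t :: p) = t.1 *: op_word X t.2 + op_poly X p.
Proof. by rewrite /op_poly big_cons. Qed.

Lemma op_poly_cat X p q : op_poly X (p ++ q) = op_poly X p + op_poly X q.
Proof. by rewrite /op_poly big_cat. Qed.

Definition ncpoly_scale (c : R[i]) p := [seq (c * t.1, t.2) | t <- p].

Lemma op_poly_scale X c p : op_poly X (ncpoly_scale c p) = c *: op_poly X p.
Proof.
rewrite /op_poly big_map scaler_sumr; apply: eq_bigr => t _.
by rewrite scalerA.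
Qed.

Lemma op_polyE X p x : op_poly X p x = \sum_(t <- p) t.1 *: op_word X t.2 x.
Proof.
elim: p => [|t p IH]; first by rewrite /op_poly !big_nil.
by rewrite op_poly_cons big_cons -IH.
Qed.

Definition mul_letter (k : 'I_n) p := [seq (t.1, k :: t.2) | t <- p].

Lemma op_poly_mul_letter X k p x : bounded_operator (tnth X k) ->
  op_poly X (mul_letter k p) x = tnth X k (op_poly X p x).
Proof.
move=> bX; elim: p => [|t p IH].
  by rewrite /op_poly !big_nil bounded_linear0.
rewrite /mul_letter /= -/(mul_letter k p) !op_poly_cons.
rewrite -[LHS]/(t.1 *: op_word X (k :: t.2) x + op_poly X (mul_letter k p) x).
rewrite -[in RHS]/(t.1 *: op_word X t.2 x + op_poly X p x).
by rewrite bounded_linearD // bounded_linearZ // IH.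
Qed.

End OperatorPolynomials.

Lemma Re_le_normc (R : realType) (z : R[i]) : `|complex.Re z|%:C <= `|z|.
Proof.
rewrite normc_def lecR -sqrtr_sqr ler_sqrt ?addr_ge0 ?sqr_ge0 //.
by rewrite lerDl sqr_ge0.
Qed.

Section Density.
Context {R : realType} {H : completeNormedModType R[i]}.
Context {ip : {dot H for Num.conj}} (hip : hilbert_norm ip).
Context {M : set (H -> H)} (hM : von_neumann_algebra ip M).
Context {n : nat} (X : n.-tuple (H -> H)).
Hypothesis XM : forall k, M (tnth X k).
Hypothesis Xsa : forall k, selfadjoint ip (tnth X k).
Context (xi : @l2 R H).

Local Notation b := (@rip R H ip).
Local Notation B := (@l2_form R H ip).
Let hB := l2_real_hilbert hip.
Let hb := H_real_hilbert hip.

Definition cyclic_space : set (@l2 R H) :=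
  [set u | exists p, forall i, u i = op_poly X p (xi i)].

Let W0 : cyclic_space 0.
Proof. by exists [::] => i; rewrite /op_poly big_nil. Qed.

Let WD u v : cyclic_space u -> cyclic_space v -> cyclic_space (u + v).
Proof.
move=> [p hp] [q hq]; exists (p ++ q) => i.
by rewrite op_poly_cat l2_valD hp hq.
Qed.

Let WZ (c : R[i]) u : cyclic_space u -> cyclic_space (c *: u).
Proof.
by move=> [p hp]; exists (ncpoly_scale c p) => i; rewrite op_poly_scale l2_valZ hp.
Qed.

Let bX k : bounded_operator (tnth X k) := vna_bounded hM (XM k).

Let WX k u : cyclic_space u -> cyclic_space (l2_map (bX k) u).
Proof.
move=> [p hp]; exists (mul_letter k p) => i.
by rewrite op_poly_mul_letter // l2_mapE hp.
Qed.

Let e := rhf_proj hB W0 WD WZ.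
(** The entries of the projection as an infinite matrix of operators on [H]: [g j i] leads from
    coordinate [j] to coordinate [i]. *)
Let g j i x : H := e (l2_delta j x) i.

Let g_sym i j x z : b (g j i x) z = b x (g i j z).
Proof.
rewrite -(l2_form_delta hip j x) -(rhf_proj_sym hB W0 WD WZ).
by rewrite ripC -(l2_form_delta hip) l2_formC.
Qed.

(** The projection is built from the real form, so its compatibility with complex scalars has to be
    recovered: multiplication by [c] and its adjoint, multiplication by the conjugate, both preserve
    the complex subspace. *)
Let e_scale c u : e (c *: u) = c *: e u.
Proof.

apply: (@rhf_proj_comm _ _ _ hB _ W0 WD WZ (fun u => c *: u)
  (fun u => conjc c *: u) (complex.Re `|c|)) => [v w|v|v w|w|w].
- by rewrite scalerBr.
- rewrite -(@ler_pXn2r _ 2) // ?nnegrE ?mulr_ge0 ?rhf_norm_ge0 //; last first.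
    by rewrite -ler0c RRe_real // ger0_real.
  rewrite exprMn !(rhf_normE hB); apply: (l2_form_le hip) => k.
  have E i : rnorm ((c *: v) i) ^+ 2 = complex.Re `|c| ^+ 2 * rnorm (v i) ^+ 2.
    rewrite -exprMn; congr (_ ^+ 2); apply: complexI.
    rewrite rmorphM -!rnormE l2_valZ normrZ [X in _ = X * _]RRe_real ?ger0_real //.
    by rewrite [X in _ = _ * X]RRe_real ?ger0_real.
  under eq_bigr do rewrite E.
  by rewrite -mulr_sumr ler_wpM2l ?sqr_ge0 // (sum_rnorm_le hip).
- by congr (limn _); apply/funext => k; apply: eq_bigr => l _; rewrite rip_conj.
- exact: WZ.
- exact: WZ.
Qed.

Let g_scale i j c x : g j i (c *: x) = c *: g j i x.
Proof.
rewrite /g -l2_valZ -e_scale; congr (l2_val (e _) i).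
apply/val_inj/funext => l /=; rewrite -[RHS]/(c *: (if l == j then x else 0)).
by case: eqP => // _; rewrite scaler0.
Qed.

(* Weak form of the commutation of [T] with the projection [e] in each pair of
   coordinates: it is visibly closed in the weak operator topology. *)
Definition commutes_with_cyclic_projection (T : H -> H) :=
  forall i j x z, b (T (g j i x)) z = b (T x) (g i j z).

Lemma commuteP T i j x : commutes_with_cyclic_projection T ->
  T (g j i x) = g j i (T x).
Proof.
move=> cT; apply: (rip_ext hip) => z.
exact: etrans (cT _ _ _ _) (esym (g_sym _ _ _ _)).
Qed.

(** [vna_generated] is an intersection of von Neumann algebras, so [y] commutes with the projection
    once this set is one of them and contains [X]. The condition [M T] provides boundedness and
    adjoints. *)
Lemma commutant_vna :
  von_neumann_algebra ip [set T | M T /\ commutes_with_cyclic_projection T].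
Proof.
split.
- by move=> T [/(vna_bounded hM)].
- by split; [exact: vna_id hM|move=> i j x z; exact: g_sym].
- move=> S T [MS cS] [MT cT]; split; first exact: vna_add hM _ _ MS MT.
  by move=> i j x z; rewrite !(rhfDl hb) cS cT.
- move=> c T [MT cT]; split; first exact: vna_scale hM _ _ MT.
  by move=> i j x z; rewrite !rip_conj cT g_scale.
- move=> S T [MS cS] [MT cT]; split; first exact: vna_comp hM _ _ MS MT.
  by move=> i j x z /=; rewrite commuteP // cS.
- move=> T [MT cT]; have [S MS ST] := vna_adjoint hM MT; exists S => //.
  split=> // i j x z.
  have ST' u v : b (S u) v = b u (T v) by rewrite ripC /rip -ST -/(rip _ _) ripC.
  by rewrite ST' ripC -cT ripC ST'.
- move=> T bT app; split.
    apply: (vna_wot_closed hM) => // m x y eps eps0.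
    by have [S [MS _] hS] := app m x y eps eps0; exists S.
  move=> i j x z; apply/eqP; rewrite -subr_eq0 -normr_le0.
  apply/ler_addgt0Pr => d d0; rewrite add0r.
  have d2 : 0 < (d / 2)%:C by rewrite ltcR divr_gt0.
  (* The relation for [T] compares two matrix coefficients, so it is enough to approximate [T] at
     these two pairs of vectors. *)
  pose x2 (k : 'I_2) := if k == ord0 then g j i x else x.
  pose y2 (k : 'I_2) := if k == ord0 then z else g i j z.
  have [S [MS cS] hS] := app 2 x2 y2 _ d2.
  have near u v : `|ip (S u - T u) v| < (d / 2)%:C -> `|b (S u) v - b (T u) v| < d / 2.
    move=> h; rewrite -ltcR; apply: le_lt_trans h.
    rewrite /rip.
    rewrite -raddfN -raddfD /= -linearBl.
    exact: Re_le_normc.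
  have h1 := near _ _ (hS ord0); have h2 := near _ _ (hS ord_max).
  rewrite /= in h1 h2.
  have := cS i j x z; rewrite !ltr_norml in h1 h2 * => E.
  by rewrite ler_norml; apply/andP; split; lra.
Qed.

(** By selfadjointness the cyclic space is also invariant under the adjoint of [tnth X k], as
    [rhf_proj_comm] requires. *)
Lemma commute_X k : commutes_with_cyclic_projection (tnth X k).
Proof.
have [K _ hK] := l2_map_bounded hip (bX k).
have eX u : e (l2_map (bX k) u) = l2_map (bX k) (e u).
  apply: (@rhf_proj_comm _ _ _ hB _ W0 WD WZ _ (l2_map (bX k)) K) => //.
  - exact: l2_mapB.
  - by move=> v w; apply: l2_map_adjoint; exact: Xsa.
  - exact: WX.
  - exact: WX.
move=> i j x z; rewrite -g_sym; congr (rip _ z).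
by rewrite /g -(l2_map_delta (bX k)) eX l2_mapE.
Qed.

Lemma generated_M y : vna_generated ip (range (tnth X)) y -> M y.
Proof. by apply; split=> // _ [k _ <-]. Qed.

Lemma vna_generated_strong_closure y : vna_generated ip (range (tnth X)) y ->
  forall eps, 0 < eps -> exists p, forall r,
    \sum_(i < r) rnorm ((y - op_poly X p) (xi i)) ^+ 2 <= eps.
Proof.
move=> gy.
have /(gy _)[My cy] : von_neumann_algebra ip
    [set T | M T /\ commutes_with_cyclic_projection T] /\
    range (tnth X) `<=` [set T | M T /\ commutes_with_cyclic_projection T].
  by split=> [|_ [k _ <-]]; [exact: commutant_vna|split=> //; exact: commute_X].
have bdy := vna_bounded hM My.
have [K K0 hK] := l2_map_bounded hip bdy.
(* The empty word puts [xi] in the cyclic space, so [e] fixes it. *)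
have Wxi : cyclic_space xi.
  exists [:: (1, [::])] => i.
  by rewrite op_polyE big_seq1 /= scale1r.
(* Commutation with the entries [g] concerns vectors with a single nonzero coordinate. It is summed
   here to finite truncations, and carried to [xi] by continuity below. *)
have ey u k : e (l2_map bdy (l2_trunc u k)) = l2_map bdy (e (l2_trunc u k)).
  elim: k => [|m IH].
    have -> : l2_trunc u 0 = 0 by rewrite /l2_trunc big_ord0.
    have -> : l2_map bdy 0 = 0.
      by apply/val_inj/funext => i /=; exact: bounded_linear0.
    have -> : e 0 = 0 by exact: rhf_proj_id.
    by apply/val_inj/funext => i /=; rewrite bounded_linear0.
  have mapD v w : l2_map bdy (v + w) = l2_map bdy v + l2_map bdy w.
    by apply/val_inj/funext => i /=; exact: bounded_linearD.
  rewrite /l2_trunc big_ord_recr /= -/(l2_trunc u m) mapD /e !rhf_projD -/e IH mapD.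
  congr (_ + _); rewrite l2_map_delta; apply/val_inj/funext => i.
  exact: esym (commuteP i m (u m) cy).
have : rhf_closure (B := B) cyclic_space (l2_map bdy xi).
  apply/(rhf_closureP hB) => d d0.
  have dK : 0 < d / 2 / (K + 1) by rewrite !divr_gt0 // ltr_wpDl.
  have [m hm] := l2_trunc_cvg hip xi (exprn_gt0 2 dK).
  have : rhf_closure (B := B) cyclic_space (l2_map bdy (e (l2_trunc xi m))).
    by rewrite -ey; exact: rhf_proj_closure.
  move=> /(rhf_closureP hB)/(_ _ (divr_gt0 d0 (ltr0Sn R 1)))[w Ww hw].
  exists w => //.
  rewrite -(subrKA (l2_map bdy (e (l2_trunc xi m)))).
  apply: (le_lt_trans (rhf_normD hB _ _)); rewrite (splitr d) ltr_leD //; last exact: ltW.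
  rewrite -l2_mapB; apply: (le_lt_trans (hK _)).
  have -> : xi - e (l2_trunc xi m) = e (xi - l2_trunc xi m).
    by rewrite /e rhf_projD rhf_projN (rhf_proj_id hB W0 WD WZ Wxi).
  have := rhf_proj_le hB W0 WD WZ (xi - l2_trunc xi m); rewrite -/e => le1.
  move: hm; rewrite -(rhf_norm_lt hB) // ltr_pdivlMr; last by rewrite ltr_wpDl.
  apply: le_lt_trans; rewrite mulrC.
  apply: (le_trans (ler_wpM2r K0 le1)); rewrite ler_wpM2l ?rhf_norm_ge0 //.
  by rewrite lerDl.
move=> h eps eps0; have [w [p hp] hw] := h _ eps0; exists p => r.
apply: le_trans (ltW hw).
have := sum_rnorm_le hip (l2_map bdy xi - w) r.
by under eq_bigr do rewrite l2_valB hp.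
Qed.

End Density.

(** * Normality of the trace *)

Section Interleave.
Context {R : realType} {H : completeNormedModType R[i]}.
Implicit Types (xi eta zeta : nat -> H).

(** Quantified over every [F] because the sequences are merged before the polynomial [p] is chosen,
    while [F] will be the squared norm of [(y - p(X)) x]. *)
Definition sums_dominated xi zeta := forall F : H -> R, (forall x, 0 <= F x) ->
  forall r, exists s, \sum_(i < r) F (xi i) <= \sum_(i < s) F (zeta i).

Lemma sums_dominated_trans xi eta zeta : sums_dominated xi eta ->
  sums_dominated eta zeta -> sums_dominated xi zeta.
Proof.
move=> h1 h2 F F0 r; have [s hs] := h1 F F0 r; have [t ht] := h2 F F0 s.
by exists t; apply: le_trans ht.
Qed.

Definition interleave xi eta (m : nat) : H := if odd m then eta m./2 else xi m./2.

Lemma sum_interleave xi eta (F : H -> R) r :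
  \sum_(i < r.*2) F (interleave xi eta i)
  = \sum_(i < r) F (xi i) + \sum_(i < r) F (eta i).
Proof.
elim: r => [|r IH]; first by rewrite !big_ord0 addr0.
rewrite doubleS !big_ord_recr /= IH /interleave /= odd_double /= doubleK.
by rewrite uphalf_double; ring.
Qed.

Lemma interleave_summable xi eta : square_summable xi -> square_summable eta ->
  square_summable (interleave xi eta).
Proof.
move=> /square_summableP[A hA] /square_summableP[B hB].
apply/square_summableP; exists (A + B) => r.
apply: (@le_trans _ _ (\sum_(i < r.*2) rnorm (interleave xi eta i) ^+ 2)); last first.
  by rewrite (sum_interleave xi eta (fun x => rnorm x ^+ 2)) lerD.
have rr : (r <= r.*2)%N by rewrite -addnn leq_addr.
rewrite -!(big_mkord predT (fun i => rnorm (interleave xi eta i) ^+ 2)).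
by rewrite (big_cat_nat (leq0n r) rr) /= lerDl sumr_ge0 // => i _; exact: sqr_ge0.
Qed.

(** An ultraweak neighbourhood involves finitely many sequences, the density result only one;
    interleaving merges them. *)
Lemma dominating_sequence (s : seq (nat -> H)) :
  (forall xi, xi \in s -> square_summable xi) ->
  exists2 zeta, square_summable zeta & forall xi, xi \in s -> sums_dominated xi zeta.
Proof.
elim: s => [|xi s IH] hs.
  exists (fun=> 0) => //; apply/square_summableP; exists 0 => r.
  by rewrite big1 // => i _; rewrite /rnorm normr0 expr0n.
have [eta he hd] := IH (fun x hx => hs x (mem_behead (s := xi :: s) hx)).
have hx := hs _ (mem_head xi s).
exists (interleave xi eta); first exact: interleave_summable.
move=> z; rewrite inE => /orP[/eqP ->|/hd hz].
  by move=> F F0 r; exists r.*2; rewrite sum_interleave lerDl sumr_ge0.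
apply: sums_dominated_trans hz _ => F F0 r.
by exists r.*2; rewrite sum_interleave lerDr sumr_ge0.
Qed.

End Interleave.

Section StarPolynomials.
Context {R : realType} {H : completeNormedModType R[i]} {n : nat}.
Context {ip : {dot H for Num.conj}}.
Implicit Types (Z : n.-tuple (H -> H)) (p q : seq (R[i] * seq 'I_n)).

(** The formal adjoint for selfadjoint letters; being formal, it can be evaluated at operators and
    at matrices. *)
Definition ncpoly_star p := [seq (conjc t.1, rev t.2) | t <- p].

Definition ncpoly_mul p q := [seq (s.1 * t.1, s.2 ++ t.2) | s <- p, t <- q].

Lemma op_word_cat Z v w x : op_word Z (v ++ w) x = op_word Z v (op_word Z w x).
Proof. by elim: v => //= i v ->. Qed.

Lemma op_word_adjoint Z w : (forall i, selfadjoint ip (tnth Z i)) ->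
  is_adjoint ip (op_word Z (rev w)) (op_word Z w).
Proof.
move=> Zsa; elim: w => // i w IH x y.
by rewrite /= rev_cons -cats1 op_word_cat /= Zsa IH.
Qed.

Lemma ip_sumr I (r : seq I) (F : I -> H) x :
  ip x (\sum_(j <- r) F j) = \sum_(j <- r) ip x (F j).
Proof. exact: linear_sumr. Qed.

Lemma ip_suml I (r : seq I) (F : I -> H) x :
  ip (\sum_(j <- r) F j) x = \sum_(j <- r) ip (F j) x.
Proof. exact: linear_sumlz. Qed.

Lemma op_poly_adjoint Z p : (forall i, selfadjoint ip (tnth Z i)) ->
  is_adjoint ip (op_poly Z (ncpoly_star p)) (op_poly Z p).
Proof.
move=> Zsa x y; rewrite !op_polyE ip_suml ip_sumr big_map; apply: eq_bigr => t _.
by rewrite ipZl ipZr conjcK (op_word_adjoint t.2 Zsa).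
Qed.

Lemma op_word_bounded Z w : (forall i, bounded_operator (tnth Z i)) ->
  linear (op_word Z w).
Proof.
by move=> bZ; elim: w => [|i w IH] c u v //=; rewrite IH (bZ i).1.
Qed.

Lemma op_poly_mul Z p q x : (forall i, bounded_operator (tnth Z i)) ->
  op_poly Z (ncpoly_mul p q) x = op_poly Z p (op_poly Z q x).
Proof.
move=> bZ; rewrite !op_polyE big_allpairs_dep /=; apply: eq_bigr => s _.
have lw := op_word_bounded s.2 bZ.
have w0 : op_word Z s.2 0 = 0.
  by have := lw (-1) 0 0; rewrite !scaleN1r !addNr.
elim: q => [|t q IH]; first by rewrite !big_nil w0 scaler0.
by rewrite !big_cons lw IH scalerDr scalerA op_word_cat.
Qed.

End StarPolynomials.

Section Normality.
Context {R : realType} {H : completeNormedModType R[i]}.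
Context {ip : {dot H for Num.conj}} (hip : hilbert_norm ip).
Context {M : set (H -> H)} (hM : von_neumann_algebra ip M).
Context {phi : (H -> H) -> R[i]} (hphi : faithful_normal_tracial_state ip M phi).

Let hb := H_real_hilbert hip.

Lemma vna_zero : M 0.
Proof. by rewrite -(scale0r (idfun : H -> H)); apply: (vna_scale hM); exact: vna_id hM. Qed.

Lemma state_zero : phi 0 = 0.
Proof.
by rewrite -(scale0r (idfun : H -> H)) (state_scale hphi) ?mul0r //; exact: vna_id hM.
Qed.

Lemma op_word_M n (Z : n.-tuple (H -> H)) w : (forall i, M (tnth Z i)) -> M (op_word Z w).
Proof.
move=> ZM; elim: w => [|i w IH] /=; first exact: vna_id hM.
exact: (vna_comp hM).
Qed.

Lemma op_poly_M n (Z : n.-tuple (H -> H)) p : (forall i, M (tnth Z i)) -> M (op_poly Z p).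
Proof.
move=> ZM; elim: p => [|t p IH]; first by rewrite /op_poly big_nil; exact: vna_zero.
rewrite op_poly_cons; apply: (vna_add hM) => //; apply: (vna_scale hM).
exact: op_word_M.
Qed.

Lemma state_op_poly n (Z : n.-tuple (H -> H)) p : (forall i, M (tnth Z i)) ->
  phi (op_poly Z p) = \sum_(t <- p) t.1 * phi (op_word Z t.2).
Proof.
move=> ZM; elim: p => [|t p IH]; first by rewrite /op_poly !big_nil state_zero.
have Mw := op_word_M t.2 ZM.
rewrite op_poly_cons big_cons (state_add hphi) ?(state_scale hphi) ?IH //.
  exact: (vna_scale hM).
exact: op_poly_M.
Qed.

(** Real and imaginary part are each at most half of the right-hand side, the imaginary part being
    [rip x ('i *: y)]. *)
Lemma norm_ip_le x y : `|ip x y| <= (rnorm x ^+ 2 + rnorm y ^+ 2)%:C.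
Proof.
have rip_le (u v : H) : `|rip (ip := ip) u v| <= (rnorm u ^+ 2 + rnorm v ^+ 2) / 2.
  have := rhf_ge0 hb (u - v); have := rhf_ge0 hb (u + v).
  rewrite !(rhfE hb) -!(ripxx hip) (ripC v) ler_norml => h1 h2.
  by apply/andP; split; lra.
have iy : rnorm ('i *: y) = rnorm y.
  by rewrite /rnorm normrZ normc_def /= expr0n expr1n add0r sqrtr1 mul1r.
have h1 := rip_le x y; have := rip_le x ('i *: y); rewrite iy -ip_Im => h2.
rewrite [ip x y]complexE; apply: (le_trans (ler_normD _ _)).
rewrite normrM !normc_def /= !expr0n !expr1n add0r sqrtr1 !addr0 !sqrtr_sqr.
by rewrite mul1r -rmorphD lecR; lra.
Qed.

(** For a divergent sequence [limn] is the default value 0, which [0 <= C] covers. *)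
Lemma norm_limn_le (u : nat -> R[i]^o) (C : R[i]) :
  0 <= C -> (forall m, `|u m| <= C) -> `|limn u| <= C.
Proof.
move=> C0 uC; have [cu|] := pselect (cvgn u); last first.
  by move=> /dvgP ->; rewrite normr0.
have Cr : C = (complex.Re C)%:C by rewrite RRe_real // ger0_real.
have lr : `|limn u| = (complex.Re `|limn u|)%:C by rewrite RRe_real // ger0_real.
rewrite Cr lr lecR; apply/ler_addgt0Pr => e e0.
have /cvgrPdist_le/(_ e%:C) := cu; rewrite ltcR => /(_ e0)[m _ hm].
rewrite -lecR rmorphD /= -Cr -lr addrC -[X in `|X|](subrK (u m)).
by apply: (le_trans (ler_normD _ _)); rewrite lerD //; exact: (hm m (leqnn m)).
Qed.

(** The last of [n.+1] variables minus [p] in the others, to be evaluated both at [rcons X y] and at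
    its microstates. *)
Definition ncpoly_sub n (p : seq (R[i] * seq 'I_n)) : seq (R[i] * seq 'I_n.+1) :=
  (1, [:: ord_max]) ::
  [seq (- t.1, [seq widen_ord (leqnSn n) i | i <- t.2]) | t <- p].

Context {n : nat} {X : n.-tuple (H -> H)} {y : H -> H}.
Let Z : n.+1.-tuple (H -> H) := [tuple of rcons X y].

Lemma tnth_rcons_max : tnth Z ord_max = y.
Proof. by rewrite (tnth_nth y) /= nth_rcons size_tuple ltnn eqxx. Qed.

Lemma tnth_rcons_widen i : tnth Z (widen_ord (leqnSn n) i) = tnth X i.
Proof. by rewrite !(tnth_nth y) /= nth_rcons size_tuple ltn_ord. Qed.

Lemma op_ncpoly_sub p :
  op_poly Z (ncpoly_sub p) = y - op_poly X p.
Proof.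
rewrite /ncpoly_sub op_poly_cons scale1r; congr (_ + _).
  by rewrite /op_word /= tnth_rcons_max.
rewrite /op_poly big_map -sumrN; apply: eq_bigr => t _ /=.
rewrite scaleNr; congr (- (_ *: _)).
by elim: t.2 => //= i w ->; rewrite tnth_rcons_widen.
Qed.

Hypothesis XM : forall k, M (tnth X k).
Hypothesis Xsa : forall k, selfadjoint ip (tnth X k).
Hypothesis ysa : selfadjoint ip y.
Hypothesis gy : vna_generated ip (range (tnth X)) y.

Lemma rcons_forall (P : (H -> H) -> Prop) :
  P y -> (forall i, P (tnth X i)) -> forall i, P (tnth Z i).
Proof.
move=> Py PX i; have [j -> |->] := @unliftP _ ord_max i; last by rewrite tnth_rcons_max.
have -> : lift ord_max j = widen_ord (leqnSn n) j.
  by apply/val_inj; rewrite /= /bump leqNgt ltn_ord.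
by rewrite tnth_rcons_widen.
Qed.

(** For [T] the product of [y - p(X)] with its adjoint, <T xi_i, eta_i> is the inner product of the
    images of [xi_i] and [eta_i] under [y - p(X)]. Approximating [y] strongly on these vectors
    therefore puts [T] in the neighbourhood of 0 given by normality. *)
Lemma state_difference_small (eps : R) : 0 < eps -> exists p,
  let D := ncpoly_sub p in
  `|phi (op_poly Z (ncpoly_mul (ncpoly_star D) D))| < eps%:C.
Proof.
move=> eps0.
have My := generated_M hM XM gy.
have ZM := rcons_forall My XM.
have Zsa := rcons_forall ysa Xsa.
have bZ i := vna_bounded hM (ZM i).
have [|N [xi [eta [_ [sxe /complex_gt0[d d0 ->] hphi0]]]]] :=
  state_normal hphi (e := eps%:C) vna_zero; first by rewrite ltcR.
have [|zeta sz dom] := @dominating_sequence _ H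
  ([seq xi j | j : 'I_N] ++ [seq eta j | j : 'I_N]).
  move=> z; rewrite mem_cat => /orP[] /mapP[j _ ->].
    exact: (sxe j).1.
  exact: (sxe j).2.
have zl : zeta \in l2_pred by apply/asboolP.
(* A quarter of [d]: the sequences [xi] and [eta] contribute [d / 4] each, and the limit stays
   strictly below [d]. *)
have [p hp] := vna_generated_strong_closure hip hM XM Xsa (L2 zl) gy
  (divr_gt0 d0 (ltr0Sn R 3)).
exists p => D; set T := op_poly Z _.
have := hphi0 T (op_poly_M _ ZM); rewrite state_zero !subr0; apply => j.
have Tip u v : ip (T u) v = ip ((y - op_poly X p) u) ((y - op_poly X p) v).
  rewrite /T op_poly_mul // -op_ncpoly_sub.
  by rewrite ipC -(op_poly_adjoint D Zsa) -ipC.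
have bound w : w \in [seq xi j | j : 'I_N] ++ [seq eta j | j : 'I_N] ->
    forall r, \sum_(i < r) rnorm ((y - op_poly X p) (w i)) ^+ 2 <= d / 4.
  move=> /dom hw r.
  have [s hs] := hw (fun x => rnorm ((y - op_poly X p) x) ^+ 2) (fun x => sqr_ge0 _) r.
  exact: le_trans hs (hp s).
apply: (@le_lt_trans _ _ (d / 2)%:C); last first.
  by rewrite ltcR ltr_pdivrMr // ltr_pMr // ltr1n.
apply: norm_limn_le; first by rewrite ler0c divr_ge0 // ltW.
move=> m; rewrite /ultraweak_sums /series /=.
apply: (le_trans (ler_norm_sum _ _ _)).
apply: (@le_trans _ _ (\sum_(i < m) (rnorm ((y - op_poly X p) (xi j i)) ^+ 2
    + rnorm ((y - op_poly X p) (eta j i)) ^+ 2)%:C)).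
  by rewrite big_mkord; apply: ler_sum => i _; rewrite Tip norm_ip_le.
rewrite -rmorph_sum lecR big_split /=.
have h1 := bound (xi j) _ m; have h2 := bound (eta j) _ m.
have -> : d / 2 = d / 4 + d / 4 by field.
by rewrite lerD ?h1 ?h2 // mem_cat map_f ?orbT ?mem_enum.
Qed.

End Normality.

(** * Matrix polynomials *)

Section MatrixPolynomials.
Context {R : realType} {k : nat}.
Local Notation C := R[i].
Implicit Types (B : 'M[C]_k).

Definition adjmx B : 'M[C]_k := map_mx conjc B^T.

Lemma adjmxE B p q : adjmx B p q = conjc (B q p). Proof. by rewrite !mxE. Qed.

Lemma adjmxM A B : adjmx (A *m B) = adjmx B *m adjmx A.
Proof. by rewrite /adjmx trmx_mul map_mxM. Qed.

Lemma adjmxD A B : adjmx (A + B) = adjmx A + adjmx B.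
Proof. by apply/matrixP => p q; rewrite !mxE rmorphD. Qed.

Lemma adjmxZ c B : adjmx (c *: B) = conjc c *: adjmx B.
Proof. by apply/matrixP => p q; rewrite !mxE rmorphM. Qed.

Lemma adjmx1 : adjmx 1%:M = 1%:M.
Proof. by rewrite /adjmx trmx1 map_mx1. Qed.

Lemma adjmx0 : adjmx 0 = 0.
Proof. by apply/matrixP => p q; rewrite !mxE conjc0. Qed.

Lemma hermsymmx_adj B : B \is hermsymmx -> adjmx B = B.
Proof. by move=> /is_hermitianmxP; rewrite expr0 scale1r => {2}->. Qed.

Lemma ntrace_adjmxM B :
  ntrace (adjmx B *m B) = k%:R^-1 * \sum_p \sum_q `|B p q| ^+ 2.
Proof.
congr (_ * _); rewrite /mxtrace exchange_big /=; apply: eq_bigr => q _.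
rewrite mxE; apply: eq_bigr => p _.
by rewrite adjmxE mulrC -conjCE -normCK.
Qed.

Context {N : nat}.
Implicit Types (A : N.-tuple 'M[C]_k) (p q : seq (C * seq 'I_N)).

Definition mx_poly A p : 'M[C]_k := \sum_(t <- p) t.1 *: mx_word A t.2.

Lemma mx_word_cat A v w : mx_word A (v ++ w) = mx_word A v *m mx_word A w.
Proof.
elim: v => [|i v IH]; first by rewrite [mx_word A [::]]big_nil mul1mx.
by rewrite cat_cons /mx_word !big_cons -!/(mx_word A _) IH mulmxA.
Qed.

Lemma mx_word_rev A w : (forall i, tnth A i \is hermsymmx) ->
  mx_word A (rev w) = adjmx (mx_word A w).
Proof.
move=> hA; elim: w => [|i w IH]; first by rewrite /mx_word big_nil adjmx1.
rewrite rev_cons -cats1 mx_word_cat IH.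
rewrite /mx_word !big_cons big_nil mulmx1 -!/(mx_word A _) adjmxM.
by rewrite (hermsymmx_adj (hA i)).
Qed.

Lemma mx_poly_star A p : (forall i, tnth A i \is hermsymmx) ->
  mx_poly A (ncpoly_star p) = adjmx (mx_poly A p).
Proof.
move=> hA; elim: p => [|t p IH]; first by rewrite /mx_poly !big_nil adjmx0.
rewrite /mx_poly /= !big_cons -!/(mx_poly A _) adjmxD adjmxZ -mx_word_rev //.
by rewrite -IH.
Qed.

Lemma mx_poly_mul A p q : mx_poly A (ncpoly_mul p q) = mx_poly A p *m mx_poly A q.
Proof.
rewrite /mx_poly big_allpairs_dep mulmx_suml; apply: eq_bigr => s _.
rewrite mulmx_sumr; apply: eq_bigr => t _ /=.
by rewrite mx_word_cat -scalemxAl -scalemxAr scalerA.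
Qed.

Lemma ntrace_mx_poly A p :
  ntrace (mx_poly A p) = \sum_(t <- p) t.1 * ntrace (mx_word A t.2).
Proof.
rewrite /mx_poly /ntrace raddf_sum mulr_sumr; apply: eq_bigr => t _ /=.
by rewrite mxtraceZ mulrCA.
Qed.

(** Induction by the product rule a b - a' b' = (a - a') b + a' (b - b'), which is why the bound [c]
    on the entries is carried along. The constants may depend on [k]. *)
Lemma mx_word_lipschitz (w : seq 'I_N) (K : C) : 0 <= K ->
  exists c l : C, [/\ 0 <= c, 0 <= l &
   forall A A' (d : C), 0 <= d ->
     (forall i r s, `|tnth A i r s| <= K) ->
     (forall i r s, `|tnth A' i r s| <= K) ->
     (forall i r s, `|tnth A i r s - tnth A' i r s| <= d) ->
     forall r s, `|mx_word A w r s| <= c /\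
       `|mx_word A w r s - mx_word A' w r s| <= l * d].
Proof.
move=> K0; elim: w => [|i w [c [l [c0 l0 IH]]]].
  exists 1, 0; split=> // A A' d d0 _ _ _ r s.
  rewrite /mx_word !big_nil subrr normr0 mul0r mxE; split=> //.
  by case: (_ == _); rewrite ?normr1 ?normr0.
exists (K * c *+ k), ((c + K * l) *+ k); split.
- by rewrite mulrn_wge0 // mulr_ge0.
- by rewrite mulrn_wge0 // addr_ge0 // mulr_ge0.
move=> A A' d d0 hA hA' hd r0 s.
have {}IH r := IH A A' d d0 hA hA' hd r s.
rewrite /mx_word !big_cons -!/(mx_word _ w) !mxE; split.
  apply: (le_trans (ler_norm_sum _ _ _)).
  apply: (@le_trans _ _ (\sum_(j < k) K * c)); last by rewrite sumr_const card_ord.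
  by apply: ler_sum => r _; rewrite normrM ler_pM // (IH r).1.
rewrite -sumrB; apply: (le_trans (ler_norm_sum _ _ _)).
apply: (@le_trans _ _ (\sum_(j < k) (c + K * l) * d)); last first.
  by rewrite sumr_const card_ord mulrnAl.
apply: ler_sum => r _.
have -> : forall a a' b b' : C, a * b - a' * b' = (a - a') * b + a' * (b - b').
  by move=> a a' b b'; ring.
apply: (le_trans (ler_normD _ _)); rewrite !normrM mulrDl [c * d]mulrC -mulrA.
by rewrite lerD // ler_pM // ?(IH r).1 ?(IH r).2.
Qed.

Lemma mx_poly_lipschitz p (K : C) : 0 <= K ->
  exists l : C, 0 <= l /\
   forall A A' (d : C), 0 <= d ->
     (forall i r s, `|tnth A i r s| <= K) ->
     (forall i r s, `|tnth A' i r s| <= K) ->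
     (forall i r s, `|tnth A i r s - tnth A' i r s| <= d) ->
     forall r s, `|mx_poly A p r s - mx_poly A' p r s| <= l * d.
Proof.
move=> K0; elim: p => [|t p [l [l0 IH]]].
  exists 0; split=> // A A' d d0 _ _ _ r s.
  by rewrite /mx_poly !big_nil subrr normr0 mul0r.
have [c [l' [_ l'0 hw]]] := mx_word_lipschitz t.2 K0.
exists (`|t.1| * l' + l); split; first by rewrite addr_ge0 // mulr_ge0.
move=> A A' d d0 hA hA' hd r s.
rewrite /mx_poly !big_cons -!/(mx_poly _ p) !mxE.
have -> : forall a a' b b' e : C, e * a + b - (e * a' + b') = e * (a - a') + (b - b').
  by move=> a a' b b' e; ring.
apply: (le_trans (ler_normD _ _)); rewrite mulrDl lerD ?IH //.
rewrite normrM -mulrA ler_wpM2l //.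
by case: (hw A A' d d0 hA hA' hd r s).
Qed.

End MatrixPolynomials.

Section SelfadjointMatrices.
Context {R : realType} {k : nat}.
Implicit Types x y : 'I_k -> 'I_k -> R.

Lemma sa_mxB x y : sa_mx x - sa_mx y = sa_mx (fun p q => x p q - y p q).
Proof.
apply/matrixP => p q; rewrite !mxE; case: ifP => _; last case: ifP => _.
- by rewrite -rmorphB -mulrBr.
- by apply/eqP; rewrite eq_complex /= -!mulrBr !eqxx.
- by apply/eqP; rewrite eq_complex /= -!mulrBr -opprD -mulrBr !eqxx.
Qed.

Lemma sum_normsq_sa_mx x : (0 < k)%N ->
  \sum_p \sum_q `|sa_mx x p q| ^+ 2 = (k%:R * \sum_p \sum_q x p q ^+ 2)%:C.
Proof.
move=> k0; rewrite rmorphM /= -sa_mx_isometry.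
have := ntrace_adjmxM (sa_mx x); rewrite hermsymmx_adj ?sa_mx_hermsym // => ->.
rewrite mulrA.
by rewrite rmorph_nat divff ?mul1r // pnatr_eq0 -lt0n.
Qed.

(** An entry is at most the unnormalised Hilbert-Schmidt norm, here [sqrt k * t]; the cruder [k * t]
    avoids the root. *)
Lemma sa_mx_entry_le x (t : R) p q : 0 <= t ->
  \sum_p \sum_q x p q ^+ 2 <= t ^+ 2 -> `|sa_mx x p q| <= (k%:R * t)%:C.
Proof.
move=> t0 h; have k0 : (0 < k)%N by case: k p => // -[].
have kt0 : 0 <= k%:R * t by rewrite mulr_ge0.
rewrite -(@ler_pXn2r _ 2) ?nnegrE ?normr_ge0 ?ler0c //.
apply: (@le_trans _ _ (\sum_p \sum_q `|sa_mx x p q| ^+ 2)).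
  rewrite (bigD1 p) //= (bigD1 q) //= -addrA lerDl.
  by rewrite addr_ge0 ?sumr_ge0 // => i _; rewrite ?sumr_ge0 // => *; exact: exprn_ge0.
rewrite sum_normsq_sa_mx // -rmorphXn lecR exprMn.
apply: ler_pM => //; first by do 2?[rewrite sumr_ge0 // => ? _]; exact: sqr_ge0.
by rewrite expr2 ler_peMl // ler1n.
Qed.

End SelfadjointMatrices.

(** * Volume of microstate spaces *)

Lemma big_triple (T : Type) (idx : T) (op : Monoid.com_law idx)
    (I J K : finType) (F : I * J * K -> T) :
  \big[op/idx]_j F j = \big[op/idx]_i \big[op/idx]_a \big[op/idx]_b F (i, a, b).
Proof.
rewrite (pair_bigA _ (fun i a => \big[op/idx]_b F (i, a, b))) /=.
rewrite (pair_bigA _ (fun ia b => F (ia.1, ia.2, b))) /=.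
by apply: eq_bigr => -[[i a] b] _.
Qed.

Section MicrostateVolume.
Context {R : realType} {n k : nat}.
Hypothesis k0 : (0 < k)%N.

Lemma mx_poly_ncpoly_sub (A : n.+1.-tuple 'M[R[i]]_k) p :
  mx_poly A (ncpoly_sub p) = tnth A ord_max
    - mx_poly [tuple tnth A (widen_ord (leqnSn n) i) | i < n] p.
Proof.
rewrite /mx_poly big_cons /= scale1r /mx_word big_cons big_nil mulmx1; congr (_ + _).
rewrite big_map -sumrN; apply: eq_bigr => t _ /=; rewrite scaleNr.
congr (- (_ *: _)); rewrite big_map; apply: eq_bigr => i _.
by rewrite tnth_mktuple.
Qed.

Lemma sqr_normB3_le (a b c : R[i]) :
  `|a - b + c| ^+ 2 <= 3 * (`|a| ^+ 2 + `|b| ^+ 2 + `|c| ^+ 2).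
Proof.
have E (z : R[i]) : `|z| = (complex.Re `|z|)%:C by rewrite RRe_real // ger0_real.
have := le_trans (ler_normD (a - b) c) (lerD (ler_normB a b) (lexx `|c|)).
rewrite (E a) (E b) (E c) (E (a - b + c)) -!rmorphXn -!rmorphD.
rewrite -(rmorph_nat (real_complex R) 3) -rmorphM.
have n0 (z : R[i]) : 0 <= complex.Re `|z| by rewrite -ler0c -E.
rewrite !lecR; move: (n0 a) (n0 b) (n0 c) (n0 (a - b + c)).
move: (complex.Re `|a|) (complex.Re `|b|) (complex.Re `|c|) (complex.Re `|a - b + c|).
move=> x y z t x0 y0 z0 t0 h.
apply: (@le_trans _ _ ((x + y + z) ^+ 2)).
  by rewrite ler_pXn2r ?nnegrE ?addr_ge0.
have := sqr_ge0 (x - y); have := sqr_ge0 (x - z); have := sqr_ge0 (y - z); nra.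
Qed.

(** Points (a, b) and (a', b') of [S] satisfy b - b' = (b - p(a)) - (b' - p(a')) + (p(a) - p(a')).
    For nearly equal [a], each of the three terms has normalised square at most [r ^+ 2 / 9], and
    squaring a sum of three costs a factor 3: hence the 9. *)
Lemma lebesgue_volume_near_poly (p : seq (R[i] * seq 'I_n)) (c r : R)
    (S : set ('I_n.+1 * 'I_k * 'I_k -> R)) :
  0 < c -> 0 < r ->
  (forall x, S x -> forall i, i != ord_max ->
    \sum_s \sum_t x (i, s, t) ^+ 2 <= c ^+ 2) ->
  (forall x, S x -> \sum_s \sum_t `|mx_poly (sa_tuple x) (ncpoly_sub p) s t| ^+ 2
    <= (k%:R * (r ^+ 2 / 9))%:C) ->
  (lebesgue_volume S <=
    ((8 * c / k%:R) ^+ (n * k ^ 2) * (8 * r / k%:R) ^+ (k ^ 2))%:E)%E.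
Proof.
move=> c0 r0 Sc Sr.
have kR : 0 < k%:R :> R by rewrite ltr0n.
pose m : 'I_n.+1 := ord_max.
pose rad (i : 'I_n.+1) := if i == m then r else c.
have rad0 i : 0 < rad i by rewrite /rad; case: eqP.
(* Division by [rad / k] turns the ball of radius [rad] in the coordinates of one matrix into one of
   squared radius [k ^ 2], its number of coordinates, as [volume_tube] asks. *)
pose s (i : 'I_n.+1 * 'I_k * 'I_k) : R := rad i.1.1 / k%:R.
have [|l [l0 hl]] := @mx_poly_lipschitz R k n p (k%:R * c)%:C.
  by rewrite ler0c mulr_ge0 // ltW.
have lE : l = (complex.Re l)%:C by rewrite RRe_real // ger0_real.
pose lr := complex.Re l; have lr0 : 0 <= lr by rewrite -ler0c -lE.
(* The size allowed for an entry of p(a) - p(a'): over [k ^ 2] entries the squares add up to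
   [k * (r ^+ 2 / 9)]. *)
pose e := Num.sqrt (r ^+ 2 / 9 / k%:R).
have e0 : 0 < e by rewrite sqrtr_gt0 !divr_gt0 // exprn_gt0.
(* Coordinates within [delta] give matrix entries within [k * (k * delta)], which the Lipschitz
   constant turns into at most [e]; the 1 keeps the denominator positive. *)
have [delta delta0 deltaE] : exists2 delta, 0 < delta
    & delta = e / ((lr + 1) * k%:R ^+ 2).
  exists (e / ((lr + 1) * k%:R ^+ 2)) => //.
  by rewrite divr_gt0 // mulr_gt0 ?exprn_gt0 // ltr_wpDl.
have card : #|{: 'I_n.+1 * 'I_k * 'I_k}| = (n.+1 * k ^ 2)%N.
  by rewrite !card_prod !card_ord mulnA.
have tube x x' : S x -> S x' ->
    (forall i, i.1.1 != m -> `|x i - x' i| <= delta) ->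
    \sum_a \sum_b (x (m, a, b) - x' (m, a, b)) ^+ 2 <= r ^+ 2.
  move=> Sx Sx' close.
  rewrite -(@ler_pM2l _ k%:R) // -lecR -sum_normsq_sa_mx // -sa_mxB.
  pose A := @sa_tuple R n.+1 k x; pose A' := @sa_tuple R n.+1 k x'.
  pose A0 := [tuple tnth A (widen_ord (leqnSn n) i) | i < n].
  pose A0' := [tuple tnth A' (widen_ord (leqnSn n) i) | i < n].
  have wm i : widen_ord (leqnSn n) i != m by rewrite -val_eqE /= ltn_eqF.
  have entry z : S z -> forall i a b,
      `|tnth [tuple tnth (@sa_tuple R n.+1 k z) (widen_ord (leqnSn n) j) | j < n] i a b|
      <= (k%:R * c)%:C.
    move=> Sz i a b; rewrite !tnth_mktuple; apply: sa_mx_entry_le; first exact: ltW.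
    exact: Sc.
  have PP a b : `|mx_poly A0' p a b - mx_poly A0 p a b| ^+ 2 <= (e ^+ 2)%:C.
    rewrite rmorphXn ler_pXn2r ?nnegrE ?normr_ge0 ?ler0c ?(ltW e0) //.
    have kd0 : 0 <= k%:R * delta by rewrite mulr_ge0 // ltW.
    have d0 : 0 <= (k%:R * (k%:R * delta))%:C by rewrite ler0c mulr_ge0.
    apply: (le_trans (hl A0' A0 _ d0 (entry _ Sx') (entry _ Sx) _ a b)) => [i a' b'|].
      rewrite !tnth_mktuple; set w := widen_ord _ i.
      have -> : forall f g : 'I_k -> 'I_k -> R, sa_mx f a' b' - sa_mx g a' b'
          = sa_mx (fun a b => f a b - g a b) a' b'.
        by move=> f g; rewrite -sa_mxB [RHS]mxE [X in _ = _ + X]mxE.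
      apply: sa_mx_entry_le => //.
      apply: (@le_trans _ _ (\sum_(a < k) \sum_(b < k) delta ^+ 2)).
        apply: ler_sum => a1 _; apply: ler_sum => b1 _.
        rewrite -[leLHS]real_normK ?num_real // ler_pXn2r ?nnegrE ?(ltW delta0) //.
        by rewrite distrC; apply: close; exact: wm.
      by rewrite !sumr_const card_ord -mulrnA -[leLHS]mulr_natl natrM exprMn (expr2 k%:R).
    rewrite lE -rmorphM lecR -/lr deltaE.
    have -> : lr * (k%:R * (k%:R * (e / ((lr + 1) * k%:R ^+ 2)))) = lr / (lr + 1) * e.
      by field; rewrite !gt_eqF // ltr_wpDl.
    by rewrite ler_piMl ?(ltW e0) // ler_pdivrMr ?ltr_wpDl // mul1r lerDl.
  have Tm z : tnth (@sa_tuple R n.+1 k z) m = mx_poly (sa_tuple z) (ncpoly_sub p) +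
      mx_poly [tuple tnth (@sa_tuple R n.+1 k z) (widen_ord (leqnSn n) j) | j < n] p.
    by rewrite mx_poly_ncpoly_sub subrK.
  apply: (@le_trans _ _ (\sum_a \sum_b 3 *
     (`|mx_poly A (ncpoly_sub p) a b| ^+ 2 + `|mx_poly A' (ncpoly_sub p) a b| ^+ 2
       + (e ^+ 2)%:C))).
    apply: ler_sum => a _; apply: ler_sum => b _.
    have -> : (sa_mx (fun s t => x (m, s, t)) - sa_mx (fun s t => x' (m, s, t))) a b
      = mx_poly A (ncpoly_sub p) a b - mx_poly A' (ncpoly_sub p) a b
        + (mx_poly A0 p a b - mx_poly A0' p a b).
      have := Tm x; have := Tm x'; rewrite !tnth_mktuple => -> ->.
      by rewrite !mxE; ring.
    apply: (le_trans (sqr_normB3_le _ _ _)); rewrite ler_wpM2l // lerD2l.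
    by rewrite distrC PP.
  have sumk (f : 'I_k -> 'I_k -> R[i]) d : \sum_a \sum_b (f a b + d)
      = \sum_a \sum_b f a b + k%:R ^+ 2 * d.
    under eq_bigr do rewrite big_split /= sumr_const card_ord.
    by rewrite big_split /= sumr_const card_ord -mulrnA -[_ *+ (k * k)]mulr_natl natrM.
  under eq_bigr do rewrite -mulr_sumr.
  rewrite -mulr_sumr sumk.
  under eq_bigr do rewrite big_split.
  rewrite big_split /=.
  have ke : k%:R ^+ 2 * (e ^+ 2)%:C = (k%:R * (r ^+ 2 / 9))%:C.
    rewrite -(rmorph_nat (real_complex R) k) -rmorphXn -rmorphM; congr (_%:C).
    rewrite sqr_sqrtr; last by rewrite !divr_ge0 // sqr_ge0.
    by field; rewrite gt_eqF.
  rewrite ke; apply: (le_trans (ler_wpM2l _ (lerD (lerD (Sr _ Sx) (Sr _ Sx')) (lexx _)))).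
    by [].
  rewrite -!rmorphD -(rmorph_nat (real_complex R) 3) -rmorphM lecR.
  have := mulr_ge0 (ltW kR) (sqr_ge0 r); lra.
apply: (le_trans (@volume_tube R _ (m, Ordinal k0, Ordinal k0) s
  (fun j => j.1.1 != m) S delta _ delta0 _)).
- by move=> j; rewrite divr_gt0.
- move=> x x' Sx Sx' close; rewrite big_triple card natrM natrX mulr_natl.
  rewrite -[in leRHS](card_ord n.+1) -sumr_const.
  apply: ler_sum => i _; rewrite /s /=.
  have -> : k%:R ^+ 2 = (k%:R / rad i) ^+ 2 * rad i ^+ 2 :> R.
    by rewrite -exprMn divfK // gt_eqF.
  under eq_bigr => a _ do under eq_bigr => b _ do rewrite invf_div exprMn mulrC.
  under eq_bigr do rewrite -mulr_sumr.
  rewrite -mulr_sumr ler_wpM2l ?sqr_ge0 // /rad.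
  have [->|im] /= := eqVneq i m; last exact: Sc.
  by apply: tube.
- rewrite lee_fin card -card -prodr_const -big_split /= big_triple big_ord_recr /=.
  have sE i : \prod_(a < k) \prod_(b < k) (8 * s (i, a, b))
      = (8 * rad i / k%:R) ^+ (k ^ 2).
    under eq_bigr do (under eq_bigr do rewrite /s mulrA /=; rewrite prodr_const card_ord).
    by rewrite prodr_const card_ord -exprM mulnn.
  rewrite sE [X in 8 * X / _]/rad eqxx.
  under eq_bigr => i _ do rewrite sE /rad -val_eqE /= ltn_eqF //.
  by rewrite prodr_const card_ord -exprM mulnC.
Qed.

End MicrostateVolume.

(** * Entropy bounds *)

Lemma limn_esup_le (R : realType) (u : nat -> \bar R) (c : \bar R) :
  (forall k, (0 < k)%N -> (u k <= c)%E) -> (limn_esup u <= c)%E.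
Proof.
move=> uc; apply: (@le_trans _ _ (ereal_sup (u @` [set k | (0 < k)%N]))).
  apply: ereal_inf_lbound; exists [set k | (0 < k)%N] => //.
  by exists 1%N.
by apply: ub_ereal_sup => _ [k k0 <-]; exact: uc.
Qed.

Lemma norm_ntrace_microstate (R : realType) (H : completeNormedModType R[i])
    (phi : (H -> H) -> R[i]) (N m k : nat) (Z : N.-tuple (H -> H)) (gamma : R)
    (A : N.-tuple 'M[R[i]]_k) (p : seq (R[i] * seq 'I_N)) :
  (0 < k)%N -> 0 < gamma -> phi idfun = 1 -> microstates phi Z m gamma A ->
  (forall t, t \in p -> (size t.2 <= m)%N) ->
  `|ntrace (mx_poly A p) - \sum_(t <- p) t.1 * phi (op_word Z t.2)|
    <= (\sum_(t <- p) `|t.1|) * gamma%:C.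
Proof.
move=> k0 g0 phi1 [_ hA] pm; rewrite ntrace_mx_poly -sumrB mulr_suml.
apply: (le_trans (ler_norm_sum _ _ _)).
rewrite big_seq [leRHS]big_seq; apply: ler_sum => -[c w] /pm /= wm.
rewrite -mulrBr normrM ler_wpM2l //.
(* Microstates do not constrain the empty word, but there both [ntrace] and [phi] equal 1. *)
case: w wm => [|i w] wm; last by apply/ltW/hA.
rewrite /mx_word big_nil /= phi1 /ntrace mxtrace1 mulVf ?pnatr_eq0 -?lt0n //.
by rewrite subrr normr0 ler0c ltW.
Qed.

Section EntropyBound.
Context {R : realType} {H : completeNormedModType R[i]}.
Context {phi : (H -> H) -> R[i]} {n : nat} {Z : n.+1.-tuple (H -> H)}.
Hypothesis phi1 : phi idfun = 1.

(** Bounds the normalised square of each matrix of a microstate of order at least 2 with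
    [gamma <= 1], the last 1 absorbing [gamma]. It depends on [phi] and [Z] only, not on the choice
    of [p]. *)
Definition second_moments : R :=
  \sum_i complex.Re `|phi (op_word Z [:: i; i])| + 1.

Lemma second_moments_gt0 : 0 < second_moments.
Proof.
rewrite ltr_wpDl // sumr_ge0 // => i _.
by rewrite -ler0c RRe_real // ger0_real.
Qed.

(** The words [[:: i; i]] bound the norm of each matrix. The trace of [G] is the squared norm of b -
    p(a), and differs from its value under [phi] by at most [gamma] times the sum of the moduli of
    the coefficients. *)
Lemma microstates_vol_le (m k : nat) (gamma r : R) (p : seq (R[i] * seq 'I_n)) :
  let D := ncpoly_sub p in let G := ncpoly_mul (ncpoly_star D) D in
  (0 < k)%N -> 0 < r -> 0 < gamma <= 1 ->
  (2 <= m)%N -> (forall t, t \in G -> (size t.2 <= m)%N) ->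
  (`|\sum_(t <- G) t.1 * phi (op_word Z t.2)| + (\sum_(t <- G) `|t.1|) * gamma%:C
    <= (r ^+ 2 / 9)%:C) ->
  (vol (@microstates R H phi n.+1 Z m k gamma) <=
    ((8 * Num.sqrt second_moments / k%:R) ^+ (n * k ^ 2)
     * (8 * r / k%:R) ^+ (k ^ 2))%:E)%E.
Proof.
move=> D G k0 r0 /andP[g0 g1] m2 Gm hG.
apply: (lebesgue_volume_near_poly k0 (p := p)) => //.
- by rewrite sqrtr_gt0 second_moments_gt0.
- move=> x [_ hx] i _; rewrite sqr_sqrtr; last exact/ltW/second_moments_gt0.
  have := hx [:: i; i] m2.
  rewrite /mx_word !big_cons big_nil mulmx1 !tnth_mktuple sa_mx_isometry.
  move=> /ltW h; rewrite -lecR.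
  set s := (\sum_s _)%:C in h *.
  have : s <= `|phi (op_word Z [:: i; i])| + 1.
    have s0 : 0 <= s by rewrite ler0c; do 2?[apply: sumr_ge0 => ? _]; exact: sqr_ge0.
    rewrite -[leLHS]ger0_norm // -[X in `|X|](subrK (phi (op_word Z [:: i; i]))).
    rewrite (le_trans (ler_normD _ _)) // addrC lerD2l (le_trans h) //.
    by rewrite -[1]/(1%:C) lecR.
  move=> /le_trans -> //.
  rewrite /second_moments rmorphD lerD2r rmorph_sum (bigD1 i) //.
  rewrite [X in _ <= X + _]RRe_real ?ger0_real // lerDl sumr_ge0 // => j _.
  by rewrite [leRHS]RRe_real // ger0_real.
- move=> x [hx1 hx2]; set A := sa_tuple x.
  have k1 : k%:R != 0 :> R[i] by rewrite pnatr_eq0 -lt0n.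
  have -> : \sum_s \sum_t `|mx_poly A D s t| ^+ 2 = k%:R * ntrace (mx_poly A G).
    by rewrite mx_poly_mul mx_poly_star // ntrace_adjmxM mulrA divff // mul1r.
  rewrite rmorphM /= rmorph_nat ler_wpM2l //.
  have tr0 : 0 <= ntrace (mx_poly A G).
    rewrite mx_poly_mul mx_poly_star // ntrace_adjmxM mulr_ge0 ?invr_ge0 //.
    by do 2?[apply: sumr_ge0 => ? _]; exact: exprn_ge0.
  rewrite -(ger0_norm tr0); apply: le_trans hG.
  rewrite -[X in `|X|](subrK (\sum_(t <- G) t.1 * phi (op_word Z t.2))).
  rewrite (le_trans (ler_normD _ _)) // addrC lerD2l.
  exact: (norm_ntrace_microstate k0 g0 phi1 (conj hx1 hx2) Gm).
Qed.

(** After division by [k ^ 2] the logarithm of the denominators is [- n.+1 * ln k], which the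
    normalising term cancels. *)
Lemma entropy_term_le (v : \bar R) (c r : R) (k : nat) :
  (0 < k)%N -> 0 < c -> 0 < r ->
  (v <= ((8 * c / k%:R) ^+ (n * k ^ 2) * (8 * r / k%:R) ^+ (k ^ 2))%:E)%E ->
  ((k%:R ^- 2)%:E * lne v + (n.+1%:R * ln k%:R)%:E
    <= (n%:R * ln (8 * c) + ln (8 * r))%:E)%E.
Proof.
move=> k0 c0 r0 hv; have kR : 0 < k%:R :> R by rewrite ltr0n.
have kk : 0 < k%:R ^- 2 :> R by rewrite invr_gt0 exprn_gt0.
(* For volume zero [lne v] is [-oo], and adding a finite term leaves it so. *)
have [v0|v0] := leP v 0%E.
  by rewrite le0_lneNy // gt0_muleNy ?lte_fin // addNye leNye.
have pos x : 0 < x -> 0 < 8 * x / k%:R :> R by move=> x0; rewrite divr_gt0 ?mulr_gt0.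
set b := _ * _ in hv.
have b0 : 0 < b by rewrite mulr_gt0 ?exprn_gt0 ?pos.
have : (lne v <= (ln b)%:E)%E.
  rewrite -lne_EFin // lee_lne ?in_itv /= ?leey ?andbT ?lee_fin ?(ltW b0) //.
  exact: ltW.
move=> /(lee_wpmul2l (ltW kk : (0 <= (k%:R ^- 2)%:E)%E)) h.
apply: (le_trans (leeD h (lexx _))).
rewrite lee_fin /b lnM ?posrE ?exprn_gt0 ?pos // !lnXn ?pos //.
rewrite !ln_div ?posrE ?mulr_gt0 //.
move: (ln (8 * c)) (ln (8 * r)) (ln k%:R) => u w z.
rewrite -[(u - z) *+ _]mulr_natr -[(w - z) *+ _]mulr_natr natrM natrX -natr1.
rewrite le_eqVlt; apply/orP; left; apply/eqP; field.
by rewrite gt_eqF.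
Qed.

End EntropyBound.

Theorem corollary2p7 (R : realType) (H : completeNormedModType R[i])
    (ip : {dot H for Num.conj}) (hip : hilbert_norm ip)
    (M : set (H -> H)) (hM : von_neumann_algebra ip M)
    (phi : (H -> H) -> R[i]) (hphi : faithful_normal_tracial_state ip M phi)
    (n : nat) (hn : (1 <= n)%N) (X : n.-tuple (H -> H))
    (hXM : forall i, M (tnth X i)) (hXsa : forall i, selfadjoint ip (tnth X i))
    (y : H -> H) (hysa : selfadjoint ip y)
    (hy : vna_generated ip (range (tnth X)) y) :
  free_entropy phi [tuple of rcons X y] = -oo%E.
Proof.
have phi1 := state_unital hphi.
set Z := [tuple of rcons X y].
have ZM := rcons_forall (generated_M hM hXM hy) hXM; rewrite -/Z in ZM.
pose c := Num.sqrt (@second_moments R H phi n Z).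
have c0 : 0 < c by rewrite sqrtr_gt0 second_moments_gt0.
suff bound (a : R) : (free_entropy phi Z <= a%:E)%E.
  move: bound; case: (free_entropy phi Z) => [s| |] // bound.
    by have := bound (s - 1); rewrite lee_fin lerDl oppr_ge0 ler10.
  by have := bound 0; rewrite leye_eq.
(* The radius at which the bound of [entropy_term_le] equals [a]; [c] is already fixed and
   independent of it. *)
pose r := expR (a - n%:R * ln (8 * c)) / 8.
have r0 : 0 < r by rewrite divr_gt0 // expR_gt0.
have -> : a = n%:R * ln (8 * c) + ln (8 * r).
  by rewrite /r [8 * (_ / 8)]mulrC divfK // expRK addrC subrK.
pose eps := r ^+ 2 / 9.
have eps0 : 0 < eps by rewrite divr_gt0 // exprn_gt0.
have [p /=] := state_difference_small hip hM hphi hXM hXsa hysa hy (divr_gt0 eps0 (ltr0Sn R 1)).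
set D := ncpoly_sub p; set G := ncpoly_mul _ _ => hp.
rewrite (state_op_poly hM hphi _ ZM) in hp.
(* Order 2 controls the norms; the maximum reaches every word of [G]. *)
pose m := maxn 2 (\max_(t <- G) size t.2).
pose w : R := \sum_(t <- G) complex.Re `|t.1|.
have wE : \sum_(t <- G) `|t.1| = w%:C.
  rewrite rmorph_sum; apply: eq_bigr => t _.
  by rewrite [RHS]RRe_real // ger0_real.
have w0 : 0 <= w by rewrite -ler0c -wE sumr_ge0.
(* The value of [phi] takes half of [eps], the moment errors of total weight [w] the other half; the
   cap 1 is what [second_moments] relies on. *)
pose gamma := Num.min 1 (eps / 2 / (w + 1)).
have w1 : 0 < w + 1 by rewrite ltr_wpDl.
have g0 : 0 < gamma by rewrite lt_min ltr01 divr_gt0 // divr_gt0.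
apply: (@le_trans _ _ (free_entropy_at phi Z m gamma)).
  by apply: ereal_inf_lbound; exists m, gamma.
apply: limn_esup_le => k k0; apply: entropy_term_le => //.
apply: (microstates_vol_le phi1 (p := p)) => //.
- by rewrite g0 ge_min lexx.
- exact: leq_maxl.
- move=> t tG; apply: leq_trans (leq_maxr _ _).
  exact: (leq_bigmax_seq (F := fun t => size t.2) _ tG).
- rewrite -[ncpoly_mul _ _]/G wE -rmorphM (splitr (r ^+ 2 / 9)) rmorphD lerD //; first exact: ltW.
  rewrite lecR (@le_trans _ _ (w * (eps / 2 / (w + 1)))) //.
    by rewrite ler_wpM2l // ge_min lexx orbT.
  rewrite mulrA ler_pdivrMr // mulrC ler_wpM2l ?lerDl //.
  by rewrite ltW // divr_gt0.
Qed.
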